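(* Let $f:[0,1]\to\mathbb{R}$ and let $0<c_1<\dots<c_r<1$ ($r<\infty$) be points such that $f$ is twice differentiable with bounded second derivative on $[0,1]$ except at the points $c_1,\dots,c_r$, which are jump discontinuities of $f$ at which both one-sided limits $f(c_j-)$ and $f(c_j+)$ exist and are finite. Suppose there is $\epsilon>0$ with $f>2+\epsilon$ on $[0,1]$. For each positive integer $n$ let $D_n(f)=\det T_n(f)$, where $T_n(f)$ is the $n\times n$ tridiagonal matrix with diagonal entries $f(1/n),f(2/n),\dots,f(n/n)$ (i.e. $(k,k)$ entry $f(k/n)$), all super- and sub-diagonal entries equal to $-1$, and all other entries $0$. Let \[ G(f)=\exp\left\{\int_0^1 \log\left(\frac{f(x)+\sqrt{f^2(x)-4}}{2}\right)dx\right\},\qquad \alpha=\frac12\,\frac{f(1)+\sqrt{f^2(1)-4}}{\sqrt[4]{(f^2(0)-4)(f^2(1)-4)}}, \] and for $j=1,\dots,r$ \[ \beta_j=\frac{f(c_j-)-f(c_j+)+\sqrt{f^2(c_j+)-4}+\sqrt{f^2(c_j-)-4}}{2\sqrt[4]{(f^2(c_j+)-4)(f^2(c_j-)-4)}},\qquad \gamma_j=\frac{f(c_j+)+\sqrt{f^2(c_j+)-4}}{f(c_j-)+\sqrt{f^2(c_j-)-4}}. \] (i) If $f$ is left-continuous at each $c_j$ (i.e. $f(c_j)=f(c_j-)$), then as $n\to\infty$ \[ \frac{D_n(f)}{G(f)^n}=\alpha\prod_{j=1}^r\beta_j\,\gamma_j^{\{nc_j\}}+o(1), \] where $\{x\}=x-\lfloor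 x\rfloor$ is the fractional part of $x$. (ii) If $f$ is right-continuous at $c_j$, then the same formula holds with $\{nc_j\}$ replaced by $\{nc_j\}'$, where $\{x\}'=1+x-\lceil x\rceil$ (the fractional part of $x$, except that it equals $1$ when $x$ is an integer). *)

(* Defs.v *)
From Stdlib Require Import Reals.
From Coquelicot Require Import Coquelicot.
From HB Require Import structures.
From mathcomp Require Import all_boot all_order all_algebra.
From mathcomp Require Import Rstruct.

Set Implicit Arguments.
Unset Strict Implicit.
Unset Printing Implicit Defensive.

Local Open Scope R_scope.

Definition punctured (r : nat) (c : nat -> R) (x : R) : Prop :=
  0 <= x <= 1 /\ forall j : nat, (j < r)%N -> x <> c j.

Definition deriv_within (D : R -> Prop) (g : R -> R) (x l : R) : Prop :=
  filterlim (fun y => (g y - g x) / (y - x))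
            (within (fun y => D y /\ y <> x) (locally x)) (locally l).

Definition twice_diff_bdd (D : R -> Prop) (g : R -> R) : Prop :=
  exists (g1 g2 : R -> R) (M : R),
    (forall x, D x -> deriv_within D g x (g1 x)) /\
    (forall x, D x -> deriv_within D g1 x (g2 x)) /\
    (forall x, D x -> Rabs (g2 x) <= M).

Definition Tmat (f : R -> R) (n : nat) : 'M[R]_n :=
  \matrix_(i < n, j < n)
    (if (i == j)%N then f (INR i.+1 / INR n)
     else if ((i.+1 == j) || (j.+1 == i))%N then (-1)%R else 0%R).

Definition Dn (f : R -> R) (n : nat) : R := (\det (Tmat f n))%R.

Definition Gf (f : R -> R) : R :=
  exp (RInt (fun x => ln ((f x + sqrt (f x ^ 2 - 4)) / 2)) 0 1).

Definition alpha (f : R -> R) : R :=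
  / 2 * ((f 1 + sqrt (f 1 ^ 2 - 4))
         / sqrt (sqrt ((f 0 ^ 2 - 4) * (f 1 ^ 2 - 4)))).

(* a = f(c-), b = f(c+) *)
Definition beta (a b : R) : R :=
  (a - b + sqrt (b ^ 2 - 4) + sqrt (a ^ 2 - 4))
  / (2 * sqrt (sqrt ((b ^ 2 - 4) * (a ^ 2 - 4)))).

Definition gamma (a b : R) : R :=
  (b + sqrt (b ^ 2 - 4)) / (a + sqrt (a ^ 2 - 4)).

(* floor / ceiling; Int_part x = up x - 1 is the floor of x *)
Definition floorR (x : R) : R := IZR (Int_part x).
Definition ceilR (x : R) : R := - floorR (- x).

Definition fracR (x : R) : R := x - floorR x.
Definition fracR' (x : R) : R := 1 + x - ceilR x.

Definition main_term (f : R -> R) (r : nat) (c fl fr : nat -> R)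
    (e : R -> R) (n : nat) : R :=
  alpha f * (\prod_(j < r) (beta (fl j) (fr j) *
                 Rpower (gamma (fl j) (fr j)) (e (INR n * c j))))%R.

(* Main.v *)
(* The determinants satisfy y_{k+1} = f(k/n) y_k - y_{k-1}.  Away from the jumps this recurrence has the
   approximate decaying WKB solution psi(x) = (f(x)^2 - 4)^(-1/4) exp(-n int_0^x log lam(f)), where
   lam(t) = (t + sqrt(t^2 - 4)) / 2, with relative residual O(1/n^2).  Hence the Casoratian
   W_k = y_{k+1} psi_k - y_k psi_{k+1} changes by a factor 1 + O(1/n^2) per step, so by 1 + O(1/n) along a
   whole smooth piece.  The ratios q_k = y_{k+1} / y_k satisfy the contraction q_k = f(k/n) - 1 / q_{k-1}, so
   just before a jump c they are close to lam(f(c-)); computing W a few steps beyond the jump from this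
   value multiplies it by beta * gamma^theta + o(1), where theta = n c - m and m/n is the last sample point on the
   left of the jump.  Finally W_0 = psi(0), and at the right end W_{n-1} / psi(1) is a known multiple of D_n. *)
Require Import Defs.
From Stdlib Require Import ZArith Reals Lra.
From Coquelicot Require Import Coquelicot.
From HB Require Import structures.
From mathcomp Require Import all_boot all_order all_algebra.
From mathcomp Require Import Rstruct zify.
Local Open Scope R_scope.

(** * Mean value and Taylor estimates *)

(** The determinants are paired with the decaying solution because [shoot] grows by a factor of at
    least 1 + e per step while [wkb] decreases: the two terms of the Casoratian cannot cancel, and
    absolute residuals become relative errors. Paired with the growing solution, it would be a small
    difference of large terms. The obstacle lies at the jumps. A residual involves three
    neighbouring sample points, which must belong to one smooth piece, so a jump is crossed in a
    fixed number of exact recurrence steps, for which limits of ratios suffice. There the phase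
    splits at c into parts of lengths (2 + theta)/n and (2 - theta)/n; the imbalance produces the
    power of gamma, and beta is what remains, by a rational identity in the two roots. Since theta
    oscillates with n, nothing converges until the powers of gamma are divided out; the stated
    difference is recovered at the end from their boundedness. As f'' is merely bounded, all
    expansions rest on mean values and a Lipschitz bound for f'. *)

Lemma deriv_within_continuous (D : R -> Prop) (g : R -> R) (x l : R) :
  deriv_within D g x l -> filterlim g (within D (locally x)) (locally (g x)).
Proof.
  move=> Hd; apply/filterlim_locally => eps.
  have /filterlim_locally /(_ (mkposreal 1 Rlt_0_1)) [d Hd1] := Hd.
  have Hl : 0 < Rabs l + 1 by have := Rabs_pos l; lra.
  have He : 0 < eps / (Rabs l + 1) by apply: Rdiv_lt_0_compat => //; exact: (cond_pos eps).
  have Hm : 0 < Rmin d (eps / (Rabs l + 1)) by apply: Rmin_pos => //; exact: (cond_pos d).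
  exists (mkposreal _ Hm) => y Hy Dy.
  have Hy' : Rabs (y - x) < Rmin d (eps / (Rabs l + 1)) := Hy.
  have Hyd : Rabs (y - x) < d by apply: Rlt_le_trans Hy' _; apply: Rmin_l.
  have Hye : Rabs (y - x) < eps / (Rabs l + 1) by apply: Rlt_le_trans Hy' _; apply: Rmin_r.
  case: (Req_dec y x) => [->|Hne]; first exact: ball_center.
  have Hq : Rabs ((g y - g x) / (y - x) - l) < 1 := Hd1 y Hyd (conj Dy Hne).
  change (Rabs (g y - g x) < eps).
  have -> : g y - g x = ((g y - g x) / (y - x) - l + l) * (y - x) by field; lra.
  rewrite Rabs_mult.
  have H1 : Rabs ((g y - g x) / (y - x) - l + l) <= Rabs l + 1.
    apply: Rle_trans (Rabs_triang _ _) _; lra.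
  apply: Rle_lt_trans (Rmult_le_compat_r _ _ _ (Rabs_pos _) H1) _.
  have -> : pos eps = (Rabs l + 1) * (eps / (Rabs l + 1)) by field; lra.
  exact: Rmult_lt_compat_l.
Qed.

(* Clamping to [x, y] turns the one-sided continuity at the endpoints into two-sided continuity. *)
Lemma mvt_deriv_within (D : R -> Prop) (g g1 : R -> R) (x y : R) :
  x < y -> (forall t, x <= t <= y -> D t) ->
  (forall t, D t -> deriv_within D g t (g1 t)) ->
  exists t, x <= t <= y /\ g y - g x = g1 t * (y - x).
Proof.
  move=> Hxy HD Hd.
  set cl := fun t => Rmax x (Rmin y t).
  have Hcl : forall t, x <= cl t <= y.
    move=> t; rewrite /cl /Rmin; case: Rle_dec => *; rewrite /Rmax; case: Rle_dec => *; lra.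
  have Hid : forall t, x <= t <= y -> cl t = t.
    move=> t; rewrite /cl /Rmin; case: Rle_dec => *; rewrite /Rmax; case: Rle_dec => *; lra.
  have Hcc : forall t, filterlim cl (locally t) (locally (cl t)).
    move=> t; apply/filterlim_locally => eps; exists eps => s Hs.
    have Hs' : Rabs (s - t) < eps := Hs.
    change (Rabs (cl s - cl t) < eps); apply: Rle_lt_trans Hs'.
    rewrite /cl /Rmin; case: (Rle_dec y s) => ?; case: (Rle_dec y t) => ?;
      rewrite /Rmax; repeat case: Rle_dec => ?; split_Rabs; lra.
  have [|| t [Ht E]] := MVT_gen (fun t => g (cl t)) x y g1.
  - move=> t; rewrite Rmin_left ?Rmax_right; [move=> Ht|lra|lra].
    apply/is_derive_Reals => e He.
    have /filterlim_locally /(_ (mkposreal e He)) [d H1] := Hd t (HD t ltac:(lra)).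
    have Hm : 0 < Rmin d (Rmin (t - x) (y - t)).
      apply: Rmin_pos; [exact: (cond_pos d)|apply: Rmin_pos; lra].
    exists (mkposreal _ Hm) => h Hh /= Hhd.
    have := Rmin_l d (Rmin (t - x) (y - t)); have := Rmin_r d (Rmin (t - x) (y - t)).
    have := Rmin_l (t - x) (y - t); have := Rmin_r (t - x) (y - t) => a1 a2 a3 a4.
    have {}Hhd : Rabs h < Rmin d (Rmin (t - x) (y - t)) := Hhd.
    have Hin : x <= t + h <= y by case: (Rabs_def2 _ _ Hhd) => b1 b2; lra.
    rewrite !Hid //; last lra.
    have Hne : t + h <> t by move=> E; apply: Hh; lra.
    have Hb : ball t d (t + h).
      change (Rabs (t + h - t) < d); replace (t + h - t) with h by ring; lra.
    have := H1 (t + h) Hb (conj (HD _ Hin) Hne).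
    change (Rabs ((g (t + h) - g t) / (t + h - t) - g1 t) < e ->
      Rabs ((g (t + h) - g t) / h - g1 t) < e).
    by replace (t + h - t) with h by ring.
  - move=> t _; apply/continuity_pt_filterlim.
    have Hc := deriv_within_continuous _ _ _ _ (Hd (cl t) (HD _ (Hcl t))).
    apply: (filterlim_comp _ _ _ cl g _ (within D (locally (cl t))) _ _ Hc).
    move=> P HP; move: (Hcc t _ HP); rewrite /filtermap; apply: filter_imp => s Hs.
    by apply: Hs; exact: (HD _ (Hcl s)).
  - move: E Ht; rewrite Rmin_left ?Rmax_right; [move=> E Ht|lra|lra].
    exists t; split => //; move: E; rewrite !Hid //; lra.
Qed.

(** Common interface for f, which has derivatives only within its punctured domain, and for [loglam]
    and [logamp], which have ordinary ones. Bounding the distance from t to x, instead of ordering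
    the points, lets later estimates treat forward and backward steps alike. *)
Definition mvt_on (E : R -> Prop) (g g1 : R -> R) : Prop :=
  forall x y, E x -> E y ->
  exists t, E t /\ Rabs (t - x) <= Rabs (y - x) /\ g y - g x = g1 t * (y - x).

Definition lipschitz_on (E : R -> Prop) (g : R -> R) (M : R) : Prop :=
  forall x y, E x -> E y -> Rabs (g y - g x) <= M * Rabs (y - x).

Definition convex_set (E : R -> Prop) : Prop :=
  forall x y t, E x -> E y -> x <= t <= y -> E t.

Lemma mvt_on_deriv_within (D E : R -> Prop) (g g1 : R -> R) :
  convex_set E -> (forall x, E x -> D x) ->
  (forall t, D t -> deriv_within D g t (g1 t)) -> mvt_on E g g1.
Proof.
  move=> cE ED Hd x y Ex Ey.
  case: (Rtotal_order x y) => [H|[<-|H]].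
  - have [|t [Ht Eq]] := mvt_deriv_within D g g1 x y H _ Hd.
      by move=> t Ht; apply: ED; apply: cE Ex Ey _.
    exists t; split; first exact: cE Ex Ey _.
    by split; [split_Rabs; lra | lra].
  - by exists x; split => //; split; [lra|ring].
  - have [|t [Ht Eq]] := mvt_deriv_within D g g1 y x H _ Hd.
      by move=> t Ht; apply: ED; apply: cE Ey Ex _.
    exists t; split; first exact: cE Ey Ex _.
    by split; [split_Rabs; lra | lra].
Qed.

Lemma mvt_on_is_derive (E : R -> Prop) (g g1 : R -> R) :
  convex_set E -> (forall t, E t -> is_derive g t (g1 t)) -> mvt_on E g g1.
Proof.
  move=> cE Hd x y Ex Ey.
  have Hin : forall t, Rmin x y <= t <= Rmax x y -> E t.
    move=> t; rewrite /Rmin /Rmax; case: Rle_dec => H Ht; [exact: cE Ex Ey Ht|].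
    by apply: cE Ey Ex _; lra.
  have [|| t [Ht Eq]] := MVT_gen g x y g1.
  - by move=> t Ht; apply/Hd/Hin; lra.
  - move=> t Ht; apply/continuity_pt_filterlim.
    exact: ex_derive_continuous (ex_intro _ _ (Hd t (Hin t Ht))).
  - exists t; split; first exact: Hin.
    split => //; move: Ht; rewrite /Rmin /Rmax; case: Rle_dec => *; split_Rabs; lra.
Qed.

Lemma mvt_on_lipschitz (E : R -> Prop) (g g1 : R -> R) (M : R) :
  mvt_on E g g1 -> (forall x, E x -> Rabs (g1 x) <= M) -> lipschitz_on E g M.
Proof.
  move=> Hm Hb x y Ex Ey; have [t [Et [_ ->]]] := Hm x y Ex Ey.
  rewrite Rabs_mult; apply: Rmult_le_compat_r; [exact: Rabs_pos|exact: Hb].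
Qed.

(** The mean value point moves the slope by at most M times the distance. The constant M instead of
    M / 2 is the price for asking only that [g1] be Lipschitz. *)
Lemma mvt_on_taylor (E : R -> Prop) (g g1 : R -> R) (M x y : R) :
  mvt_on E g g1 -> lipschitz_on E g1 M -> 0 <= M -> E x -> E y ->
  Rabs (g y - g x - g1 x * (y - x)) <= M * (y - x) ^ 2.
Proof.
  move=> Hm Hl HM Ex Ey; have [t [Et [Ht ->]]] := Hm x y Ex Ey.
  replace (g1 t * (y - x) - g1 x * (y - x)) with ((g1 t - g1 x) * (y - x)) by ring.
  rewrite Rabs_mult -(pow2_abs (y - x)) (_ : Rabs (y - x) ^ 2 = Rabs (y - x) * Rabs (y - x)); last ring.
  rewrite -Rmult_assoc.
  apply: Rmult_le_compat_r; first exact: Rabs_pos.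
  apply: Rle_trans (Hl _ _ Ex Et) _.
  exact: Rmult_le_compat_l.
Qed.

(** The remainder of [v] over the increment of [u] contributes K * B ^ 2; the remainder of [u],
    multiplied by the slope of [v], contributes K * M. *)
Lemma taylor_comp (u u1 v v1 : R -> R) (x y B M K : R) :
  Rabs (u y - u x) <= B * Rabs (y - x) ->
  Rabs (u y - u x - u1 x * (y - x)) <= M * (y - x) ^ 2 ->
  Rabs (v (u y) - v (u x) - v1 (u x) * (u y - u x)) <= K * (u y - u x) ^ 2 ->
  Rabs (v1 (u x)) <= K ->
  Rabs (v (u y) - v (u x) - v1 (u x) * u1 x * (y - x)) <= (K * B ^ 2 + K * M) * (y - x) ^ 2.
Proof.
  move=> H1 H2 H3 H4.
  have HK : 0 <= K by have := Rabs_pos (v1 (u x)); lra.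
  set d := y - x in H1 H2 *; set e := u y - u x in H1 H2 H3 *.
  replace (_ - _ - _ * _) with
    ((v (u y) - v (u x) - v1 (u x) * e) + v1 (u x) * (e - u1 x * d)) by (rewrite /e; ring).
  apply: Rle_trans (Rabs_triang _ _) _.
  rewrite Rmult_plus_distr_r; apply: Rplus_le_compat.
  - apply: Rle_trans H3 _; rewrite Rmult_assoc; apply: Rmult_le_compat_l => //.
    rewrite -Rpow_mult_distr -(pow2_abs e) -(pow2_abs (B * d)).
    apply: pow_incr; split; first exact: Rabs_pos.
    apply: Rle_trans H1 _; rewrite Rabs_mult; apply: Rmult_le_compat_r; first exact: Rabs_pos.
    exact: Rle_abs.
  - rewrite Rabs_mult Rmult_assoc; apply: Rmult_le_compat => //; exact: Rabs_pos.
Qed.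

Lemma exp_taylor1 (u : R) : Rabs u <= / 2 -> Rabs (exp u - 1 - u) <= 2 * u ^ 2.
Proof.
  move=> Hu.
  have H1 := exp_ineq1_le u; have H2 := exp_ineq1_le (- u).
  have Hp := exp_pos u.
  have Hu2 : u <= / 2 by split_Rabs; lra.
  have Hi : exp u * exp (- u) = 1 by rewrite -exp_plus Rplus_opp_r exp_0.
  have H3 : exp u * (1 - u) <= 1 by rewrite -Hi; apply: Rmult_le_compat_l; lra.
  have H4 : exp u <= 1 + u + 2 * u ^ 2.
    apply: (Rmult_le_reg_r (1 - u)); first lra.
    apply: Rle_trans H3 _.
    (* This is (1 + u + 2 u^2)(1 - u) - 1, so the quadratic bound dominates 1 / (1 - u). *)
    have : 0 <= u ^ 2 * (1 - 2 * u) by apply: Rmult_le_pos; [apply: pow2_ge_0|lra].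
    nra.
  rewrite Rabs_pos_eq; lra.
Qed.

(** * Determinants as solutions of a three-term recurrence *)

Definition tridiag_entry (g : nat -> R) (a b : nat) : R :=
  if (a == b)%N then g a
  else if ((a.+1 == b) || (b.+1 == a))%N then (-1)%R else 0%R.

Definition tridiag (g : nat -> R) (n : nat) : 'M[R]_n :=
  (\matrix_(i < n, j < n) tridiag_entry g i j)%R.

Lemma det_tridiag_rec (g : nat -> R) (n : nat) :
  (\det (tridiag g n.+2) = g n.+1 * \det (tridiag g n.+1) - \det (tridiag g n))%R.
Proof.
  set A := tridiag g n.+2.
  have Hlm : forall k (i : 'I_k), (lift ord_max i : nat) = i.
    by move=> k i; rewrite /= /bump leqNgt ltn_ord.
  have E0 : forall a b, (a.+1 < b)%N -> tridiag_entry g b a = 0%R /\ tridiag_entry g a b = 0%R.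
    move=> a b Hab; rewrite /tridiag_entry.
    have -> : (a == b) = false by apply/eqP; lia.
    have -> : (b == a) = false by apply/eqP; lia.
    have -> : (a.+1 == b) = false by apply/eqP; lia.
    by have -> : (b.+1 == a) = false by apply/eqP; lia.
  have E1 : forall a, tridiag_entry g a a.+1 = (-1)%R /\ tridiag_entry g a.+1 a = (-1)%R.
    move=> a; rewrite /tridiag_entry !eqxx orbT.
    have -> : (a == a.+1) = false by apply/eqP; lia.
    by have -> : (a.+1 == a) = false by apply/eqP; lia.
  rewrite (expand_det_row A ord_max) big_ord_recr /= big_ord_recr /= big1; last first.
    by move=> i _; rewrite /A /tridiag mxE (proj1 (E0 _ _ _)) ?GRing.mul0r //= ltnS ltn_ord.
  rewrite GRing.add0r.
  rewrite {1 3}/A /tridiag !mxE /=.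
  rewrite (proj2 (E1 n)) {1}/tridiag_entry eqxx GRing.addrC; congr (_ + _)%R.
  - congr (_ * _)%R; rewrite /cofactor addnn -GRing.signr_odd odd_double GRing.expr0 GRing.mul1r.
    congr (\det _)%R; apply/matrixP => i j; rewrite !mxE.
    by rewrite !Hlm.
  (* This minor lacks column n, so its last column is column n.+1 of [A], where only the bottom
     entry, -1, is nonzero. The two entries -1 and the odd sign of the cofactor leave minus the
     determinant of order n. *)
  - rewrite /cofactor /=.
    set B := row' _ _.
    have HB : forall (i j : 'I_n.+1), B i j = tridiag_entry g i (if (j < n)%N then j : nat else n.+1).
      move=> i j; rewrite /B !mxE Hlm; congr (tridiag_entry _ _ _).
      by rewrite /= /bump; have := ltn_ord j; case: (ltnP j n) => /=; lia.
    rewrite (expand_det_col B ord_max) big_ord_recr /= big1 ?GRing.add0r; last first.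
      by move=> i _; rewrite HB /= ltnn (proj2 (E0 _ _ _)) ?GRing.mul0r //= ltnS.
    rewrite HB /= ltnn (proj1 (E1 n)) /cofactor.
    have -> : row' ord_max (col' ord_max B) = tridiag g n.
      by apply/matrixP => i j; rewrite mxE mxE HB !Hlm ltn_ord mxE.
    rewrite addnn -(GRing.signr_odd _ n.*2) odd_double GRing.expr0 GRing.mul1r.
    rewrite addSn addnn -GRing.signr_odd /= odd_double /= GRing.expr1.
    rewrite -/(tridiag g n); move: (\det (tridiag g n))%R => d.
    rewrite -?RmultE -?RoppE -?R1E; ring.
Qed.

Lemma det_tridiag0 (g : nat -> R) : (\det (tridiag g 0) = 1)%R.
Proof. exact: det_mx00. Qed.

Lemma det_tridiag1 (g : nat -> R) : (\det (tridiag g 1) = g 0%N)%R.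
Proof. by rewrite det_mx11 mxE /tridiag_entry eqxx. Qed.

(* Indexing is shifted by one: shoot g k.+1 is the determinant of order k with diagonal g 1, ..., g k. *)
Fixpoint shoot (g : nat -> R) (k : nat) : R :=
  match k with
  | 0 => 0
  | k1.+1 => match k1 with 0 => 1 | k2.+1 => g k1 * shoot g k1 - shoot g k2 end
  end.

Lemma shoot_rec (g : nat -> R) (k : nat) :
  shoot g k.+2 = g k.+1 * shoot g k.+1 - shoot g k.
Proof. by []. Qed.

Definition sample (f : R -> R) (n k : nat) : R := f (INR k / INR n).

Lemma Dn_shoot (f : R -> R) (n : nat) : Dn f n = shoot (sample f n) n.+1.
Proof.
  have H : forall k, (\det (tridiag (fun i => sample f n i.+1) k))%R = shoot (sample f n) k.+1 /\
     (\det (tridiag (fun i => sample f n i.+1) k.+1))%R = shoot (sample f n) k.+2.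
    elim=> [|k [IH1 IH2]].
      by rewrite det_tridiag0 det_tridiag1 /=; split => //; ring.
    by split => //; rewrite det_tridiag_rec shoot_rec IH1 IH2.
  rewrite -(proj1 (H n)) /Dn; congr (\det _)%R.
Qed.

(** * The root of q + 1/q = t *)

Definition disc (t : R) : R := sqrt (t ^ 2 - 4).
Definition lam (t : R) : R := (t + disc t) / 2.
Definition loglam (t : R) : R := ln (lam t).
Definition logamp (t : R) : R := ln (t ^ 2 - 4) / 4.

Lemma disc_pos (t : R) : 2 < t -> 0 < disc t.
Proof. by move=> H; apply: sqrt_lt_R0; nra. Qed.

Lemma disc_sqr (t : R) : 2 < t -> disc t * disc t = t ^ 2 - 4.
Proof. by move=> H; apply: sqrt_sqrt; nra. Qed.

Lemma lam_gt (t : R) : 2 < t -> t / 2 < lam t.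
Proof. by move=> H; have := disc_pos t H; rewrite /lam; lra. Qed.

Lemma lam_inv (t : R) : 2 < t -> / lam t = (t - disc t) / 2.
Proof.
  move=> H; have h1 := lam_gt t H; have h2 := disc_sqr t H.
  apply: (Rmult_eq_reg_l (lam t)); last lra.
  rewrite Rinv_r; last lra.
  by rewrite /lam; nra.
Qed.

Lemma lam_add_inv (t : R) : 2 < t -> lam t + / lam t = t.
Proof. by move=> H; rewrite lam_inv // /lam; field. Qed.

Lemma lam_sub_inv (t : R) : 2 < t -> lam t - / lam t = disc t.
Proof. by move=> H; rewrite lam_inv // /lam; field. Qed.

Lemma exp_loglam (t : R) : 2 < t -> exp (loglam t) = lam t.
Proof. by move=> H; rewrite /loglam exp_ln //; have := lam_gt t H; lra. Qed.

Lemma exp_logamp (t : R) : 2 < t -> exp (logamp t) = sqrt (disc t).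
Proof.
  move=> H; have Hd := disc_pos t H.
  have Hs : 0 < sqrt (disc t) by apply: sqrt_lt_R0.
  rewrite /logamp -[RHS](exp_ln _ Hs); congr exp.
  have -> : t ^ 2 - 4 = sqrt (disc t) * sqrt (disc t) * (sqrt (disc t) * sqrt (disc t)).
    by rewrite sqrt_sqrt; [rewrite disc_sqr|lra].
  by rewrite !ln_mult //; [field|apply: Rmult_lt_0_compat|apply: Rmult_lt_0_compat].
Qed.

Lemma loglam_lower (e t : R) : 0 < e -> 2 + e < t -> ln (1 + e / 2) < loglam t.
Proof. by move=> He H; apply: ln_increasing; [lra|have := lam_gt t ltac:(lra); lra]. Qed.

Lemma is_derive_disc (t : R) : 2 < t -> is_derive disc t (t / disc t).
Proof.
  move=> H; have Hd := disc_pos t H; rewrite /disc.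
  auto_derive; first nra.
  by rewrite -/(disc t); field; lra.
Qed.

Lemma is_derive_loglam (t : R) : 2 < t -> is_derive loglam t (/ disc t).
Proof.
  move=> H; have Hd := disc_pos t H; have Hl := lam_gt t H.
  rewrite /loglam /lam.
  have Hx : ex_derive disc t by exists (t / disc t); exact: is_derive_disc.
  auto_derive; first by split => //; split => //; rewrite /lam in Hl; lra.
  rewrite (is_derive_unique _ _ _ (is_derive_disc t H)).
  by field; split; lra.
Qed.

Lemma is_derive_inv_disc (t : R) :
  2 < t -> is_derive (fun s => / disc s) t (- (t / (disc t * (t ^ 2 - 4)))).
Proof.
  move=> H; have Hd := disc_pos t H.
  have Hx : ex_derive disc t by exists (t / disc t); exact: is_derive_disc.
  auto_derive; first by split => //; lra.
  rewrite (is_derive_unique _ _ _ (is_derive_disc t H)) -(disc_sqr t H).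
  by field; lra.
Qed.

Lemma is_derive_logamp (t : R) : 2 < t -> is_derive logamp t (t / (2 * (t ^ 2 - 4))).
Proof.
  move=> H; rewrite /logamp; auto_derive; first nra.
  by field; nra.
Qed.

Lemma is_derive_logamp1 (t : R) :
  2 < t -> is_derive (fun s => s / (2 * (s ^ 2 - 4))) t
                     (- ((t ^ 2 + 4) / (2 * (t ^ 2 - 4) ^ 2))).
Proof.
  move=> H; auto_derive; first nra.
  by field; nra.
Qed.

Lemma half_line_taylor (a K : R) (g g1 g2 : R -> R) :
  (forall t, a < t -> is_derive g t (g1 t)) ->
  (forall t, a < t -> is_derive g1 t (g2 t)) ->
  (forall t, a < t -> Rabs (g2 t) <= K) ->
  forall t s, a < t -> a < s -> Rabs (g s - g t - g1 t * (s - t)) <= K * (s - t) ^ 2.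
Proof.
  move=> H1 H2 H3 t s Ht Hs.
  have cE : convex_set (fun t => a < t) by move=> x y z; lra.
  apply: (mvt_on_taylor (fun t => a < t)) => //.
  - exact: mvt_on_is_derive.
  - by apply: mvt_on_lipschitz H3; apply: mvt_on_is_derive.
  - by have := H3 t Ht; have := Rabs_pos (g2 t); lra.
Qed.

Lemma div_le_of (a b c : R) : 0 < b -> a <= c * b -> a / b <= c.
Proof.
  move=> Hb H; apply: (Rmult_le_reg_r b) => //.
  by rewrite /Rdiv Rmult_assoc Rinv_l; lra.
Qed.

Lemma disc_lower (e t : R) : 0 < e -> 2 + e < t -> sqrt (4 * e) <= disc t.
Proof. by move=> He Ht; apply: sqrt_le_1_alt; nra. Qed.

Lemma loglam_taylor (e : R) : 0 < e -> exists K,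
  forall t s, 2 + e < t -> 2 + e < s ->
  Rabs (loglam s - loglam t - / disc t * (s - t)) <= K * (s - t) ^ 2 /\ Rabs (/ disc t) <= K.
Proof.
  move=> He.
  have Hs : 0 < sqrt (4 * e) by apply: sqrt_lt_R0; lra.
  have Hd t : 2 + e < t -> 0 < / disc t <= / sqrt (4 * e).
    move=> Ht; split; first by apply/Rinv_0_lt_compat/disc_pos; lra.
    by apply: Rinv_le_contravar => //; apply: disc_lower.
  have He' : 0 < / e by apply: Rinv_0_lt_compat.
  (* [K] bounds the first derivative [/ disc t], and [K * / e] the second one, because t / (t^2 - 4)
     <= 1 / e once t > 2 + e. *)
  set K := / sqrt (4 * e); exists (K + K * / e).
  have HK : 0 < K by apply: Rinv_0_lt_compat.
  have HKe : 0 < K * / e by apply: Rmult_lt_0_compat.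
  move=> t s Ht Hs2; split; last first.
    by have := Hd t Ht; rewrite -/K => ?; rewrite Rabs_pos_eq; lra.
  apply: (half_line_taylor (2 + e) _ loglam (fun t => / disc t)
            (fun t => - (t / (disc t * (t ^ 2 - 4))))) => // x Hx.
  - by apply: is_derive_loglam; lra.
  - by apply: is_derive_inv_disc; lra.
  - have Hx2 : 0 < x ^ 2 - 4 by nra.
    have [d1] := Hd x Hx; rewrite -/K => d2.
    have Hq : 0 <= x / (x ^ 2 - 4) <= / e.
      split; first by apply: Rdiv_le_0_compat; lra.
      apply: div_le_of => //; apply: (Rmult_le_reg_l e) => //.
      by rewrite -Rmult_assoc Rinv_r; nra.
    have -> : x / (disc x * (x ^ 2 - 4)) = / disc x * (x / (x ^ 2 - 4)).
      by field; have := disc_pos x ltac:(lra); lra.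
    rewrite Rabs_Ropp Rabs_pos_eq; last by apply: Rmult_le_pos; lra.
    apply: (Rle_trans _ (K * / e)); last lra.
    by apply: Rmult_le_compat; lra.
Qed.

Lemma logamp_taylor (e : R) : 0 < e -> exists K,
  forall t s, 2 + e < t -> 2 + e < s ->
  Rabs (logamp s - logamp t - t / (2 * (t ^ 2 - 4)) * (s - t)) <= K * (s - t) ^ 2 /\
  Rabs (t / (2 * (t ^ 2 - 4))) <= K.
Proof.
  move=> He.
  have He' : 0 < / e by apply: Rinv_0_lt_compat.
  (* [/ e] covers the first derivative; [/ e * / e] covers the second, which is at most (t / (t^2 -
     4))^2 in absolute value. *)
  exists (/ e + / e * / e).
  have Hee : 0 < / e * / e by apply: Rmult_lt_0_compat.
  have Hq x : 2 + e < x -> 0 <= x / (x ^ 2 - 4) <= / e.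
    move=> Hx; have Hx2 : 0 < x ^ 2 - 4 by nra.
    split; first by apply: Rdiv_le_0_compat; lra.
    apply: div_le_of => //; apply: (Rmult_le_reg_l e) => //.
    by rewrite -Rmult_assoc Rinv_r; nra.
  have E1 x : 2 + e < x -> x / (2 * (x ^ 2 - 4)) = / 2 * (x / (x ^ 2 - 4)).
    by move=> Hx; field; nra.
  move=> t s Ht Hs2; split; last first.
    by have ? := Hq t Ht; rewrite E1 // Rabs_pos_eq; lra.
  apply: (half_line_taylor (2 + e) _ logamp (fun t => t / (2 * (t ^ 2 - 4)))
            (fun t => - ((t ^ 2 + 4) / (2 * (t ^ 2 - 4) ^ 2)))) => // x Hx.
  - by apply: is_derive_logamp; lra.
  - by apply: is_derive_logamp1; lra.
  - have Hx2 : 0 < x ^ 2 - 4 by nra.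
    have [q1 q2] := Hq x Hx.
    have Hle : (x ^ 2 + 4) / (2 * (x ^ 2 - 4) ^ 2) <= (x / (x ^ 2 - 4)) * (x / (x ^ 2 - 4)).
      apply: div_le_of; first by nra.
      have -> : x / (x ^ 2 - 4) * (x / (x ^ 2 - 4)) * (2 * (x ^ 2 - 4) ^ 2) = 2 * x ^ 2.
        by field; lra.
      by nra.
    rewrite Rabs_Ropp Rabs_pos_eq; last first.
      by apply: Rdiv_le_0_compat; nra.
    apply: Rle_trans Hle _; apply: (Rle_trans _ (/ e * / e)); last lra.
    by apply: Rmult_le_compat.
Qed.

Lemma continuous_loglam (t : R) : 2 < t -> continuous loglam t.
Proof.
  by move=> H; apply: (ex_derive_continuous (V := R_NormedModule)); exists (/ disc t); exact: is_derive_loglam.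
Qed.

Lemma continuous_logamp (t : R) : 2 < t -> continuous logamp t.
Proof.
  by move=> H; apply: (ex_derive_continuous (V := R_NormedModule)); exists (t / (2 * (t ^ 2 - 4)));
     exact: is_derive_logamp.
Qed.

Lemma is_lim_seq_continuous' (g : R -> R) (u : nat -> R) (l : R) :
  continuous g l -> is_lim_seq u l -> is_lim_seq (fun n => g (u n)) (g l).
Proof. by move=> H; apply: is_lim_seq_continuous; apply/continuity_pt_filterlim. Qed.

(** * Limits of ratios of consecutive determinants *)

Lemma is_lim_seq_epsP (u : nat -> R) (l : R) :
  is_lim_seq u l <-> forall e, 0 < e -> eventually (fun n => Rabs (u n - l) < e).
Proof.
  split=> H; last by apply/is_lim_seq_spec => e; apply: (H e (cond_pos e)).
  by move=> e He; have /is_lim_seq_spec /(_ (mkposreal e He)) := H.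
Qed.

Lemma eventually_ge (N : nat) : eventually (fun n => (N <= n)%N).
Proof. by exists N => n; lia. Qed.

Section Shooting.

Variables (g : nat -> R) (rho : R) (N : nat).
Hypothesis rho_pos : 0 < rho.
Hypothesis g_lower : forall k, (0 < k <= N)%N -> 2 + rho < g k.

(** The growth factor is carried through the induction: it gives y_k <= y_{k+1}, so subtracting y_k
    from more than (2 + rho) y_{k+1} leaves at least (1 + rho) y_{k+1}. *)
Lemma shoot_growth (k : nat) : (k <= N)%N ->
  0 <= shoot g k /\ 0 < shoot g k.+1 /\ (1 + rho) * shoot g k <= shoot g k.+1.
Proof.
  elim: k => [|k IH] Hk; first by rewrite /=; lra.
  have [h0 [h1 h2]] := IH (ltnW Hk).
  have hg : 2 + rho < g k.+1 by apply: g_lower; lia.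
  rewrite shoot_rec.
  have h3 : (2 + rho) * shoot g k.+1 <= g k.+1 * shoot g k.+1 by apply: Rmult_le_compat_r; lra.
  have h4 : 0 <= rho * shoot g k by apply: Rmult_le_pos; lra.
  have h5 : 0 < rho * shoot g k.+1 by apply: Rmult_lt_0_compat; lra.
  by repeat split; lra.
Qed.

Definition shoot_ratio (k : nat) : R := shoot g k.+1 / shoot g k.

Lemma shoot_ratio_lower (k : nat) : (0 < k <= N)%N -> 1 + rho <= shoot_ratio k.
Proof.
  case: k => // k Hk.
  have [_ [h1 _]] := shoot_growth k ltac:(lia).
  have [_ [_ h2]] := shoot_growth k.+1 ltac:(lia).
  apply: (Rmult_le_reg_r (shoot g k.+1)) => //.
  by rewrite /shoot_ratio /Rdiv Rmult_assoc Rinv_l; lra.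
Qed.

Lemma shoot_ratio_rec (k : nat) : (1 < k <= N)%N ->
  shoot_ratio k = g k - / shoot_ratio k.-1.
Proof.
  case: k => // -[//|k] Hk.
  have [_ [h1 _]] := shoot_growth k ltac:(lia).
  have [_ [h2 _]] := shoot_growth k.+1 ltac:(lia).
  rewrite /shoot_ratio -[Nat.pred _]/(k.+1) (shoot_rec g k.+1).
  move: (shoot g k.+2) (shoot g k.+1) h1 h2 => a b h1 h2.
  by field; lra.
Qed.

(* The recursion contracts towards the fixed point lam l of q = l - 1/q. *)
Lemma shoot_ratio_contract (k : nat) (l : R) : (1 < k <= N)%N -> 2 + rho <= l ->
  Rabs (shoot_ratio k - lam l) <=
  Rabs (g k - l) + / (1 + rho) * Rabs (shoot_ratio k.-1 - lam l).
Proof.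
  move=> Hk Hl; rewrite shoot_ratio_rec //.
  have hq := shoot_ratio_lower k.-1 ltac:(lia).
  set q := shoot_ratio k.-1 in hq *.
  have hl := lam_gt l ltac:(lra).
  have hi := lam_add_inv l ltac:(lra).
  have -> : g k - / q - lam l = (g k - l) + / (q * lam l) * (q - lam l).
    transitivity (g k - (lam l + / lam l) + / (q * lam l) * (q - lam l)); last by rewrite hi.
    by field; lra.
  apply: Rle_trans (Rabs_triang _ _) _; apply: Rplus_le_compat_l.
  rewrite Rabs_mult; apply: Rmult_le_compat_r; first exact: Rabs_pos.
  have h1 : 1 + rho <= q * lam l by nra.
  rewrite Rabs_pos_eq; first by apply: Rinv_le_contravar; lra.
  by apply/Rlt_le/Rinv_0_lt_compat; lra.
Qed.

End Shooting.

Definition unif_lower (f : R -> R) (e : R) : Prop :=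
  0 < e /\ forall x, 0 <= x <= 1 -> 2 + e < f x.

Lemma sample_lower (f : R -> R) (e : R) (n k : nat) :
  unif_lower f e -> (0 < k <= n)%N -> 2 + e < sample f n k.
Proof.
  move=> [_ Hf] Hk; apply: Hf.
  have Hn : 0 < INR n by apply: lt_0_INR; lia.
  split; first by apply: Rdiv_le_0_compat => //; apply: pos_INR.
  by apply: div_le_of => //; rewrite Rmult_1_l; apply: le_INR; lia.
Qed.

(** All fixed shifts [i] are included because the ratio at [k n] is controlled by unfolding its
    recursion an arbitrary fixed number of steps backwards. The truncated subtraction is harmless,
    since [i < k n] eventually. *)
Definition near_index (f : R -> R) (l : R) (k : nat -> nat) : Prop :=
  (forall n, (k n <= n)%N) /\ (forall i, eventually (fun n => (i < k n)%N)) /\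
  (forall i, is_lim_seq (fun n => sample f n (k n - i)%N) l).

Lemma near_index_pred (f : R -> R) (l : R) (k : nat -> nat) :
  near_index f l k -> near_index f l (fun n => (k n).-1).
Proof.
  move=> [h1 [h2 h3]]; split; first by move=> n; have := h1 n; lia.
  split=> i.
    by apply: filter_imp (h2 i.+1) => n; lia.
  apply: is_lim_seq_ext (h3 i.+1) => n; congr (sample _ _ _); lia.
Qed.

(** K contraction steps shrink a crude initial error by (1 + e)^(-K), while the drift of the samples
    over these K steps tends to 0. Hence K is fixed before n, and the induction on K runs over all
    index sequences, as each step passes to the predecessor. *)
Lemma shoot_ratio_lim (f : R -> R) (e l : R) (k : nat -> nat) :
  unif_lower f e -> 2 + e <= l -> near_index f l k ->
  is_lim_seq (fun n => shoot_ratio (sample f n) (k n)) (lam l).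
Proof.
  move=> Hf Hl Hk; have He := proj1 Hf.
  (* The crude initial error: a ratio is positive and below its sample, which is eventually below l
     + 1. *)
  set B := l + 1 + lam l.
  have hlam := lam_gt l ltac:(lra).
  have HK K : forall k, near_index f l k -> forall d, 0 < d -> eventually (fun n =>
      Rabs (shoot_ratio (sample f n) (k n) - lam l) <= B * (/ (1 + e)) ^ K + d).
    elim: K => [|K IH] {Hk}k Hk d Hd; have [h1 [h2 h3]] := Hk.
      have /is_lim_seq_epsP /(_ 1 Rlt_0_1) H0 := h3 0%N.
      apply: filter_imp (filter_and _ _ H0 (h2 1%N)) => n [Hn Hkn].
      rewrite subn0 in Hn.
      have Hs j := sample_lower f e n j Hf.
      have h4 := shoot_ratio_lower _ e n He Hs (k n) ltac:(have := h1 n; lia).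
      have h5 := shoot_ratio_lower _ e n He Hs (k n).-1 ltac:(have := h1 n; lia).
      rewrite (shoot_ratio_rec _ e n He Hs) in h4 *; try (have := h1 n; lia).
      have h6 : 0 < / shoot_ratio (sample f n) (k n).-1 by apply: Rinv_0_lt_compat; lra.
      rewrite /B /=; split_Rabs; lra.
    have /is_lim_seq_epsP /(_ (d / 2) ltac:(lra)) H0 := h3 0%N.
    have H1 := IH _ (near_index_pred _ _ _ Hk) (d / 2) ltac:(lra).
    apply: filter_imp (filter_and _ _ (filter_and _ _ H0 H1) (h2 1%N)) => n [[Hn Hq] Hkn].
    rewrite subn0 in Hn.
    have Hs j := sample_lower f e n j Hf.
    apply: Rle_trans (shoot_ratio_contract _ e n He Hs (k n) l _ Hl) _.
      by have := h1 n; lia.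
    have h7 : 0 < / (1 + e) <= 1.
      by split; [apply: Rinv_0_lt_compat|rewrite -Rinv_1; apply: Rinv_le_contravar]; lra.
    rewrite /=; set t := / (1 + e) in Hq h7 *.
    have h8 : t * Rabs (shoot_ratio (sample f n) (k n).-1 - lam l) <= t * (B * t ^ K + d / 2).
      by apply: Rmult_le_compat_l; lra.
    nra.
  apply/is_lim_seq_epsP => d Hd.
  have Ht : Rabs (/ (1 + e)) < 1.
    rewrite Rabs_pos_eq; last by apply/Rlt_le/Rinv_0_lt_compat; lra.
    by rewrite -Rinv_1; apply: Rinv_lt_contravar; lra.
  have HB : 0 < B by rewrite /B; lra.
  have [K HK'] := pow_lt_1_zero _ Ht (d / 2 / B) ltac:(apply: Rdiv_lt_0_compat; lra).
  have Hev := HK K k Hk (d / 3) ltac:(lra).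
  apply: filter_imp Hev => n Hn.
  have := HK' K (le_n K); have := Rle_abs ((/ (1 + e)) ^ K) => h1 h2.
  have h3 : B * (/ (1 + e)) ^ K <= B * (d / 2 / B) by apply: Rmult_le_compat_l; lra.
  have h4 : B * (d / 2 / B) = d / 2 by field; lra.
  lra.
Qed.

(** * Transport of the Casoratian along a smooth piece *)

(** The base point [x] is independent of [a] and [b] because a backward step expands at the right
    end of its interval. With [B] = 0 the same estimate serves for nearly constant integrands beside
    a jump. *)
Lemma RInt_affine_approx (g : R -> R) (a b A B x d : R) :
  a <= b -> ex_RInt g a b ->
  (forall t, a < t < b -> Rabs (g t - (A + B * (t - x))) <= d) ->
  Rabs (RInt g a b - (A * (b - a) + B * ((b - x) ^ 2 - (a - x) ^ 2) / 2)) <= d * (b - a).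
Proof.
  move=> Hab Hg Hd.
  have HP c : is_RInt (fun t => A + c + B * (t - x)) a b
      (minus ((A + c) * b + B * (b - x) ^ 2 / 2) ((A + c) * a + B * (a - x) ^ 2 / 2)).
    apply: (is_RInt_derive (fun t => (A + c) * t + B * (t - x) ^ 2 / 2)) => t _.
      by auto_derive => //; field.
    apply: (ex_derive_continuous (V := R_NormedModule)); auto_derive => //.
  have H1 := RInt_le _ _ _ _ Hab Hg (ex_intro _ _ (HP d)).
  have H2 := RInt_le _ _ _ _ Hab (ex_intro _ _ (HP (- d))) Hg.
  rewrite (is_RInt_unique _ _ _ _ (HP _)) in H1.
  rewrite (is_RInt_unique _ _ _ _ (HP _)) in H2.
  have {}H1 : RInt g a b <= (A + d) * b + B * (b - x) ^ 2 / 2 - ((A + d) * a + B * (a - x) ^ 2 / 2).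
    by apply: H1 => t Ht; have := Hd t Ht; split_Rabs; lra.
  have {}H2 : (A + - d) * b + B * (b - x) ^ 2 / 2 - ((A + - d) * a + B * (a - x) ^ 2 / 2) <= RInt g a b.
    by apply: H2 => t Ht; have := Hd t Ht; split_Rabs; lra.
  by apply: Rabs_le; lra.
Qed.

Lemma ex_RInt_sub01 (g : R -> R) (x y : R) :
  ex_RInt g 0 1 -> 0 <= x <= 1 -> 0 <= y <= 1 -> ex_RInt g x y.
Proof.
  move=> Hg Hx Hy.
  have H0 z : 0 <= z <= 1 -> ex_RInt g 0 z by move=> Hz; apply: ex_RInt_Chasles_1 Hg.
  by apply: ex_RInt_Chasles (H0 y Hy); apply/ex_RInt_swap/H0.
Qed.

Lemma RInt_sub01 (g : R -> R) (x y : R) :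
  ex_RInt g 0 1 -> 0 <= x <= 1 -> 0 <= y <= 1 -> RInt g 0 y - RInt g 0 x = RInt g x y.
Proof.
  move=> Hg Hx Hy.
  rewrite -(RInt_Chasles g 0 x y); try by apply: ex_RInt_sub01 => //; lra.
  by rewrite /plus /=; ring.
Qed.

(* wkb is the approximate decaying solution s^(-1/2) exp(-n int_0^x log lam) of u_{k+1} + u_{k-1} = f(k/n) u_k,
   with s = sqrt (f^2 - 4); the amplitude s^(-1/2) is what cancels the error term of order 1/n. *)
Definition phase (f : R -> R) (n : nat) (x : R) : R :=
  INR n * RInt (fun t => loglam (f t)) 0 x + logamp (f x).

Definition wkb (f : R -> R) (n : nat) (x : R) : R := exp (- phase f n x).

Lemma wkb_pos (f : R -> R) (n : nat) (x : R) : 0 < wkb f n x.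
Proof. exact: exp_pos. Qed.

Lemma exp_le_mono (x y : R) : x <= y -> exp x <= exp y.
Proof. by move=> [h|->]; [left; exact: exp_increasing|right]. Qed.

Lemma exp_pow_INR (x : R) (k : nat) : exp (INR k * x) = exp x ^ k.
Proof.
  elim: k => [|k IH]; first by rewrite /= Rmult_0_l exp_0.
  by rewrite S_INR Rmult_plus_distr_r Rmult_1_l exp_plus IH /= Rmult_comm.
Qed.

(* The Casoratian (discrete Wronskian) of shoot and wkb: constant in k if both solved the recurrence exactly. *)
Definition casorati (f : R -> R) (n k : nat) : R :=
  shoot (sample f n) k.+1 * wkb f n (INR k / INR n) -
  shoot (sample f n) k * wkb f n (INR k.+1 / INR n).

Section Piece.

Variables (f f1 : R -> R) (e M B F : R) (E : R -> Prop).
Hypothesis f_lower : unif_lower f e.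
Hypothesis f_int : ex_RInt (fun t => loglam (f t)) 0 1.
Hypothesis E_convex : convex_set E.
Hypothesis E_unit : forall x, E x -> 0 <= x <= 1.
Hypothesis f_mvt : mvt_on E f f1.
Hypothesis f1_lip : lipschitz_on E f1 M.
Hypothesis M_pos : 0 <= M.
Hypothesis f1_bound : forall x, E x -> Rabs (f1 x) <= B.
Hypothesis F_pos : 0 <= F.
Hypothesis f_upper : forall x, E x -> f x <= F.

(** By the chain rule, [L1] and [b1] are the derivatives of [loglam] and [logamp] composed with
    f. *)
Let L1 x := / disc (f x) * f1 x.
Let b1 x := f x / (2 * (f x ^ 2 - 4)) * f1 x.

Lemma piece_lower (x : R) : E x -> 2 + e < f x.
Proof. by move=> Ex; apply: (proj2 f_lower); apply: E_unit. Qed.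

Lemma piece_comp_taylor (v v1 : R -> R) :
  (exists K, forall t s, 2 + e < t -> 2 + e < s ->
    Rabs (v s - v t - v1 t * (s - t)) <= K * (s - t) ^ 2 /\ Rabs (v1 t) <= K) ->
  exists C, 0 <= C /\ (forall x, E x -> Rabs (v1 (f x) * f1 x) <= C) /\
  forall x y, E x -> E y ->
    Rabs (v (f y) - v (f x) - v1 (f x) * f1 x * (y - x)) <= C * (y - x) ^ 2.
Proof.
  move=> [K HK].
  have HK0 : 0 <= K.
    have [_ h] := HK (3 + e) (3 + e) ltac:(lra) ltac:(lra).
    by have := Rabs_pos (v1 (3 + e)); lra.
  have HMB := pow2_ge_0 B; have HBa := Rabs_pos B.
  have h1 : 0 <= K * B ^ 2 by apply: Rmult_le_pos.
  have h2 : 0 <= K * M by apply: Rmult_le_pos.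
  have h3 : 0 <= K * Rabs B by apply: Rmult_le_pos.
  exists (K * B ^ 2 + K * M + K * Rabs B); split; first lra; split.
    move=> x Ex; rewrite Rabs_mult; apply: (Rle_trans _ (K * Rabs B)); last lra.
    apply: Rmult_le_compat; try exact: Rabs_pos.
      by have [] := HK _ _ (piece_lower _ Ex) (piece_lower _ Ex).
    by apply: Rle_trans (f1_bound _ Ex) _; apply: Rle_abs.
  move=> x y Ex Ey.
  have [k1 k2] := HK _ _ (piece_lower _ Ex) (piece_lower _ Ey).
  apply: Rle_trans (taylor_comp f f1 v v1 x y B M K _ _ k1 k2) _.
  - exact: (mvt_on_lipschitz _ _ _ _ f_mvt f1_bound).
  - exact: (mvt_on_taylor _ _ _ _ _ _ f_mvt f1_lip).
  - by apply: Rmult_le_compat_r; [apply: pow2_ge_0|lra].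
Qed.

(** The Taylor remainder of the integrand is O(1/n^2) on an interval of length 1/n, hence still
    O(1/n^2) after integration and multiplication by n; the amplitude has a remainder of the same
    order. The sign [s] treats both neighbours of x together. *)
Lemma piece_phase_step : exists C, 0 <= C /\
  (forall x, E x -> Rabs (L1 x) <= C /\ Rabs (b1 x) <= C) /\
  forall n s x, (0 < n)%N -> s = 1 \/ s = -1 -> E x -> E (x + s / INR n) ->
  Rabs (phase f n (x + s / INR n) - phase f n x
        - (s * loglam (f x) + (L1 x / 2 + s * b1 x) / INR n)) <= C / INR n ^ 2.
Proof.
  have [C [HC [HC1 HL]]] := piece_comp_taylor _ _ (loglam_taylor e (proj1 f_lower)).
  have [C' [HC' [HC1' Hb]]] := piece_comp_taylor _ (fun t => t / (2 * (t ^ 2 - 4)))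
     (logamp_taylor e (proj1 f_lower)).
  exists (C + C'); split; first lra.
  split; first by move=> x Ex; have := HC1 x Ex; have := HC1' x Ex; rewrite /L1 /b1; lra.
  move=> n s x Hn Hs Ex Ey.
  have Hn' : 0 < INR n by apply: lt_0_INR; lia.
  set h := / INR n; have Hh : 0 < h by apply: Rinv_0_lt_compat.
  have Hnh : INR n * h = 1 by rewrite /h; field; lra.
  have Ed : s / INR n = s * h by [].
  rewrite Ed in Ey *.
  set y := x + s * h in Ey *.
  have Hyx : y - x = s * h by rewrite /y; ring.
  have Hs2 : s ^ 2 = 1 by case: Hs => ->; ring.
  have Ux := E_unit x Ex; have Uy := E_unit y Ey.
  have HS : Rabs (RInt (fun t => loglam (f t)) x y - (loglam (f x) * (y - x) + L1 x * (y - x) ^ 2 / 2))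
            <= C * h ^ 3.
    have Hin t : Rmin x y < t < Rmax x y -> Rabs (loglam (f t) - (loglam (f x) + L1 x * (t - x))) <= C * h ^ 2.
      move=> Ht.
      have Et : E t.
        move: Ht; rewrite /Rmin /Rmax; case: Rle_dec => Hxy Ht.
          by apply: E_convex Ex Ey _; lra.
        by apply: E_convex Ey Ex _; lra.
      replace (_ - _) with (loglam (f t) - loglam (f x) - L1 x * (t - x)) by ring.
      apply: Rle_trans (HL x t Ex Et) _; apply: Rmult_le_compat_l => //.
      rewrite -(pow2_abs (t - x)); apply: pow_incr; split; first exact: Rabs_pos.
      move: Ht; rewrite /Rmin /Rmax /y; case: Rle_dec; case: Hs => ->; split_Rabs; lra.
    have [Hs1|Hs1] := Hs.
      have Hxy : x <= y by rewrite /y Hs1; lra.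
      rewrite Rmin_left // Rmax_right // in Hin.
      have := RInt_affine_approx _ _ _ _ _ _ _ Hxy (ex_RInt_sub01 _ _ _ f_int Ux Uy) Hin.
      by rewrite Hyx Hs1; replace (x - x) with 0 by ring; move=> H;
         apply: Rle_trans (Req_le _ _ _) (Rle_trans _ _ _ H (Req_le _ _ _)); [congr Rabs|]; field.
    have Hxy : y <= x by rewrite /y Hs1; lra.
    rewrite Rmin_right // Rmax_left // in Hin.
    have := RInt_affine_approx _ _ _ _ _ _ _ Hxy (ex_RInt_sub01 _ _ _ f_int Uy Ux) Hin.
    rewrite -(opp_RInt_swap _ _ _ (ex_RInt_sub01 _ _ _ f_int Ux Uy)) /opp /=.
    rewrite -(Rabs_Ropp (- _ - _)).
    replace (x - y) with h by (rewrite /y Hs1; ring).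
    rewrite Hyx Hs1; replace (x - x) with 0 by ring; move=> H.
    apply: Rle_trans (Req_le _ _ _) (Rle_trans _ _ _ H (Req_le _ _ _)); [congr Rabs|]; field.
  have HB := Hb x y Ex Ey.
  rewrite /phase.
  have -> : forall a b c d, INR n * a + b - (INR n * c + d) = INR n * (a - c) + (b - d) by move=> *; ring.
  rewrite (RInt_sub01 _ x y f_int Ux Uy).
  set I := RInt _ x y in HS *.
  have -> : INR n * I + (logamp (f y) - logamp (f x)) - (s * loglam (f x) + (L1 x / 2 + s * b1 x) / INR n)
    = INR n * (I - (loglam (f x) * (y - x) + L1 x * (y - x) ^ 2 / 2))
      + (logamp (f y) - logamp (f x) - b1 x * (y - x)).
    rewrite Hyx Rpow_mult_distr Hs2.
    have E1 : INR n * (loglam (f x) * (s * h)) = s * loglam (f x).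
      by transitivity (s * loglam (f x) * (INR n * h)); [ring|rewrite Hnh; ring].
    have E2 : INR n * (L1 x * (1 * h ^ 2) / 2) = L1 x / 2 * h.
      by transitivity (L1 x / 2 * h * (INR n * h)); [field|rewrite Hnh; ring].
    have -> : (L1 x / 2 + s * b1 x) / INR n = L1 x / 2 * h + s * b1 x * h by rewrite /h; field; lra.
    rewrite !Rmult_minus_distr_l Rmult_plus_distr_l E1 E2; ring.
  apply: Rle_trans (Rabs_triang _ _) _.
  have -> : (C + C') / INR n ^ 2 = INR n * (C * h ^ 3) + C' * h ^ 2.
    by rewrite /h; field; lra.
  apply: Rplus_le_compat.
    rewrite Rabs_mult (Rabs_pos_eq (INR n)); last lra.
    by apply: Rmult_le_compat_l; [lra|].
  by move: HB; rewrite -/(b1 x) Hyx Rpow_mult_distr Hs2 Rmult_1_l.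
Qed.


(* The two 1/n terms of u_{k+1} + u_{k-1}, coming from the phase and from the amplitude, cancel. *)
Lemma disc_log_balance (t p : R) : 2 < t ->
  t * (/ disc t * p) / 2 = disc t * (t / (2 * (t ^ 2 - 4)) * p).
Proof.
  move=> Ht; have Hd := disc_pos t Ht; rewrite -(disc_sqr t Ht).
  by field; lra.
Qed.

Lemma exp_loglam_sign (t s : R) : 2 < t -> s = 1 \/ s = -1 ->
  exp (- (s * loglam t)) = (t - s * disc t) / 2.
Proof.
  move=> Ht [] ->.
    by rewrite Rmult_1_l exp_Ropp exp_loglam // lam_inv //; field.
  have -> : - (-1 * loglam t) = loglam t by ring.
  by rewrite exp_loglam // /lam; field.
Qed.

Lemma wkb_ratio : exists C N, 0 <= C /\ forall n s x, (N <= n)%N -> s = 1 \/ s = -1 ->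
  E x -> E (x + s / INR n) ->
  Rabs (wkb f n (x + s / INR n) / wkb f n x -
    (f x - s * disc (f x)) / 2 * (1 - (L1 x / 2 + s * b1 x) / INR n)) <= C / INR n ^ 2.
Proof.
  have [C [HC [Hb Hst]]] := piece_phase_step.
  (* Past this bound the correction [w] below, of size at most 3 C / n, is at most 1/2, as
     [exp_taylor1] requires. [K] then adds the phase error C to the quadratic term 2 w^2; [F] bounds
     the leading factor. *)
  have [N HN] := INR_unbounded (1 + 6 * C).
  set K := C + 2 * (3 * C) ^ 2.
  exists (F * K), N; split.
    by apply: Rmult_le_pos => //; rewrite /K; nra.
  move=> n s x Hn Hs Ex Ey.
  have HNn : INR N <= INR n by apply: le_INR; lia.
  have Hn1 : 1 < INR n by lra.
  have Hn0 : (0 < n)%N by apply/ltP/INR_lt => /=; lra.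
  have Hf := piece_lower x Ex; have He := proj1 f_lower.
  set q := (L1 x / 2 + s * b1 x) / INR n.
  have := Hst n s x Hn0 Hs Ex Ey; rewrite -/q.
  set u := phase f n _ - phase f n x => Hu.
  have -> : wkb f n (x + s / INR n) / wkb f n x = exp (- (s * loglam (f x))) * exp (- (u - s * loglam (f x))).
    rewrite -exp_plus /wkb /u; move: (x + s / INR n) => y.
    rewrite /Rdiv -exp_Ropp -exp_plus; congr exp; ring.
  rewrite -(exp_loglam_sign (f x) s) //; last lra.
  set w := - (u - s * loglam (f x)).
  have Hnn : 0 < / INR n ^ 2 <= / INR n.
    split; first by apply/Rinv_0_lt_compat; nra.
    by apply: Rinv_le_contravar; nra.
  have Hin : 0 < / INR n by apply/Rinv_0_lt_compat; lra.
  have Hwq : Rabs (w + q) <= C / INR n ^ 2.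
    by rewrite -Rabs_Ropp; apply: Rle_trans Hu; right; congr Rabs; rewrite /w; ring.
  have Hq : Rabs q <= 2 * C * / INR n.
    rewrite /q /Rdiv Rabs_mult (Rabs_pos_eq (/ INR n)); last lra.
    apply: Rmult_le_compat_r; first lra.
    have [h1 h2] := Hb x Ex.
    by case: Hs => ->; split_Rabs; lra.
  have Hw : Rabs w <= 3 * C * / INR n.
    have : C / INR n ^ 2 <= C * / INR n by apply: Rmult_le_compat_l; lra.
    by move: Hwq Hq; clear; split_Rabs; lra.
  have Hw2 : Rabs w <= / 2.
    apply: Rle_trans Hw _; apply: (Rmult_le_reg_r (INR n)); first lra.
    by rewrite Rmult_assoc Rinv_l; lra.
  have Hexp := exp_taylor1 w Hw2.
  have Hww : w ^ 2 <= (3 * C) ^ 2 / INR n ^ 2.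
    rewrite -(pow2_abs w).
    have -> : (3 * C) ^ 2 / INR n ^ 2 = (3 * C * / INR n) ^ 2 by field; lra.
    by apply: pow_incr; split; first exact: Rabs_pos.
  rewrite -Rmult_minus_distr_l Rabs_mult Rabs_pos_eq; last exact/Rlt_le/exp_pos.
  rewrite exp_loglam_sign //; last lra.
  have -> : F * K / INR n ^ 2 = F * (K / INR n ^ 2) by rewrite /Rdiv; ring.
  have Hd := disc_pos (f x) ltac:(lra); have Hl := lam_inv (f x) ltac:(lra).
  have Hl0 : 0 < / lam (f x) by apply: Rinv_0_lt_compat; have := lam_gt (f x) ltac:(lra); lra.
  have HF := f_upper x Ex.
  apply: Rmult_le_compat; try exact: Rabs_pos.
  - by case: Hs => ->; lra.
  - by case: Hs => ->; lra.
  - rewrite /K.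
    have -> : (C + 2 * (3 * C) ^ 2) / INR n ^ 2 = C / INR n ^ 2 + 2 * ((3 * C) ^ 2 / INR n ^ 2).
      by field; lra.
    by move: Hexp Hwq Hww; clear; split_Rabs; lra.
Qed.

Lemma wkb_residual : exists C N, 0 <= C /\ forall n x, (N <= n)%N ->
  E x -> E (x + / INR n) -> E (x - / INR n) ->
  Rabs (wkb f n (x + / INR n) + wkb f n (x - / INR n) - f x * wkb f n x)
    <= C / INR n ^ 2 * wkb f n x.
Proof.
  have [C [N [HC H]]] := wkb_ratio.
  exists (2 * C), N.+1; split; first lra.
  move=> n x Hn Ex Ep Em.
  have Hn' : 0 < INR n by apply: lt_0_INR; lia.
  have E1 : x + / INR n = x + 1 / INR n by field; lra.
  have E2 : x - / INR n = x + -1 / INR n by field; lra.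
  rewrite E1 E2 in Ep Em *.
  have Hw := wkb_pos f n x.
  have Hp := H n 1 x (ltnW Hn) (or_introl erefl) Ex Ep.
  have Hm := H n (-1) x (ltnW Hn) (or_intror erefl) Ex Em.
  have -> : wkb f n (x + 1 / INR n) + wkb f n (x + -1 / INR n) - f x * wkb f n x
     = (wkb f n (x + 1 / INR n) / wkb f n x + wkb f n (x + -1 / INR n) / wkb f n x - f x) * wkb f n x.
    by field; lra.
  rewrite Rabs_mult (Rabs_pos_eq (wkb f n x)); last lra.
  apply: Rmult_le_compat_r; first lra.
  have Hbal := disc_log_balance (f x) (f1 x) ltac:(have := piece_lower x Ex; have := proj1 f_lower; lra).
  rewrite -/(L1 x) -/(b1 x) in Hbal.
  set r1 := _ / wkb f n x in Hp *; set r2 := wkb f n (x + -1 / INR n) / _ in Hm *.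
  set m1 := _ / 2 * _ in Hp; set m2 := _ / 2 * _ in Hm.
  (* In the sum the terms of order 1/n combine to f L1 / 2 - disc(f) b1, which [Hbal] makes
     vanish. *)
  have Hsum : m1 + m2 = f x.
    transitivity (f x - (f x * L1 x / 2 - disc (f x) * b1 x) / INR n).
      by rewrite /m1 /m2; field; lra.
    by rewrite Hbal /Rdiv; ring.
  rewrite -{}Hsum.
  have -> : 2 * C / INR n ^ 2 = C / INR n ^ 2 + C / INR n ^ 2 by rewrite /Rdiv; ring.
  move: Hp Hm; clear; split_Rabs; lra.
Qed.

(** The leading phase increment is at least [l0] > 0, uniformly on the piece, and outweighs the
    corrections, of total size at most 3 C / n, as soon as n exceeds 3 C / [l0]. *)
Lemma wkb_decr : exists N, forall n x, (N <= n)%N ->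
  E x -> E (x + / INR n) -> wkb f n (x + / INR n) <= wkb f n x.
Proof.
  have [C [HC [Hb Hst]]] := piece_phase_step.
  have He := proj1 f_lower.
  set l0 := ln (1 + e / 2).
  have Hl0 : 0 < l0 by rewrite /l0 -ln_1; apply: ln_increasing; lra.
  have [N HN] := INR_unbounded (1 + 3 * C / l0).
  exists N => n x Hn Ex Ey.
  have HNn : INR N <= INR n by apply: le_INR; lia.
  have Hq : 0 <= 3 * C / l0 by apply: Rdiv_le_0_compat; lra.
  have Hn0 : (0 < n)%N by apply/ltP/INR_lt => /=; lra.
  have E1 : x + / INR n = x + 1 / INR n by rewrite /Rdiv Rmult_1_l.
  rewrite E1 in Ey *.
  have Hu := Hst n 1 x Hn0 (or_introl erefl) Ex Ey.
  have Hl := loglam_lower e (f x) He (piece_lower x Ex).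
  rewrite -/l0 in Hl.
  have Hin : 0 < / INR n by apply/Rinv_0_lt_compat; lra.
  have Hnn : / INR n ^ 2 <= / INR n by apply: Rinv_le_contravar; nra.
  have h1 : C / INR n ^ 2 <= C * / INR n by apply: Rmult_le_compat_l; lra.
  have h2 : - (2 * C * / INR n) <= (L1 x / 2 + 1 * b1 x) / INR n.
    have [h1' h2'] := Hb x Ex.
    rewrite Ropp_mult_distr_l; apply: Rmult_le_compat_r; first lra.
    by move: h1' h2' HC; clear; split_Rabs; lra.
  have h3 : 3 * C * / INR n <= l0.
    apply: (Rmult_le_reg_r (INR n)); first lra.
    rewrite Rmult_assoc Rinv_l; last lra.
    have -> : 3 * C * 1 = l0 * (3 * C / l0) by field; lra.
    by apply: Rmult_le_compat_l; lra.
  rewrite /wkb; apply: exp_le_mono.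
  by move: Hu; clear -h1 h2 h3 Hl; split_Rabs; lra.
Qed.

(** The subtracted product is at most the first one divided by 1 + e, since [shoot] gains this
    factor and [wkb] does not increase. This converts an error measured against [shoot] times [wkb]
    into one relative to the Casoratian. *)
Lemma casorati_pos (n k : nat) : (k < n)%N ->
  wkb f n (INR k.+1 / INR n) <= wkb f n (INR k / INR n) ->
  e / (1 + e) * (shoot (sample f n) k.+1 * wkb f n (INR k / INR n)) <= casorati f n k /\
  0 < casorati f n k.
Proof.
  move=> Hk Hw; have He := proj1 f_lower.
  have Hs j := sample_lower f e n j f_lower.
  have [h0 [h1 h2]] := shoot_growth _ e n He Hs k (ltnW Hk).
  have hw := wkb_pos f n (INR k / INR n).
  have hpos : 0 < e / (1 + e) * (shoot (sample f n) k.+1 * wkb f n (INR k / INR n)).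
    by apply: Rmult_lt_0_compat; [apply: Rdiv_lt_0_compat; lra|apply: Rmult_lt_0_compat].
  suff : e / (1 + e) * (shoot (sample f n) k.+1 * wkb f n (INR k / INR n)) <= casorati f n k by lra.
  rewrite /casorati.
  move: (shoot _ k.+1) (shoot _ k) h0 h1 h2 (wkb f n (INR k / INR n)) (wkb f n (INR k.+1 / INR n)) hw Hw {hpos}.
  move=> a b h0 h1 h2 v w hw Hw.
  have h3 : b * w <= b * v by apply: Rmult_le_compat_l.
  have h4 : b <= a / (1 + e) by apply: (Rmult_le_reg_l (1 + e)); [lra|apply: Rle_trans h2 _; right; field; lra].
  have h5 : b * v <= a / (1 + e) * v by apply: Rmult_le_compat_r; lra.
  have -> : e / (1 + e) * (a * v) = a * v - a / (1 + e) * v by field; lra.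
  lra.
Qed.

(** The end condition concerns [b.+1] because the Casoratian at [b] already reads [wkb] there. *)
Lemma casorati_transport : exists C N, forall n a b, (N <= n)%N -> (a <= b < n)%N ->
  E (INR a / INR n) -> E (INR b.+1 / INR n) ->
  0 < casorati f n a /\ Rabs (casorati f n b - casorati f n a) <= (exp (C / INR n) - 1) * casorati f n a.
Proof.
  have [C [N1 [HC Hres]]] := wkb_residual.
  have [N2 Hdec] := wkb_decr.
  have He := proj1 f_lower.
  set kap := e / (1 + e).
  have Hkap : 0 < kap by apply: Rdiv_lt_0_compat; lra.
  exists (C / kap), (N1 + N2).+1 => n a b Hn Hab Ea Eb.
  have Hn' : 0 < INR n by apply: lt_0_INR; lia.
  have Hin : 0 < / INR n by apply: Rinv_0_lt_compat.
  have Estep k : INR k.+1 / INR n = INR k / INR n + / INR n by rewrite S_INR; field; lra.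
  have Ein k : (a <= k <= b.+1)%N -> E (INR k / INR n).
    move=> Hk; apply: E_convex Ea Eb _.
    by split; apply: Rmult_le_compat_r; try lra; apply: le_INR; lia.
  have Hd k : (a <= k <= b)%N -> wkb f n (INR k.+1 / INR n) <= wkb f n (INR k / INR n).
    move=> Hk; rewrite Estep; apply: Hdec; first lia.
      by apply: Ein; lia.
    by rewrite -Estep; apply: Ein; lia.
  have Hpos k : (a <= k <= b)%N ->
     kap * (shoot (sample f n) k.+1 * wkb f n (INR k / INR n)) <= casorati f n k /\ 0 < casorati f n k.
    by move=> Hk; apply: casorati_pos; [lia|apply: Hd].
  have Wa := proj2 (Hpos a ltac:(lia)).
  split=> //.
  (* Relative change per step: the residual constant over n^2, divided by the fraction [kap] of
     [shoot] times [wkb] that the Casoratian retains. *)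
  set eta := C / kap / INR n ^ 2.
  have Heta : 0 <= eta.
    by apply: Rmult_le_pos; [apply: Rdiv_le_0_compat|apply/Rlt_le/Rinv_0_lt_compat/pow_lt].
  have Hone k : (a <= k < b)%N ->
      Rabs (casorati f n k.+1 - casorati f n k) <= eta * casorati f n k.
    move=> Hk.
    have Hk1 : E (INR k.+1 / INR n) by apply: Ein; lia.
    have Em : INR k.+1 / INR n - / INR n = INR k / INR n by rewrite Estep; ring.
    have := Hres n (INR k.+1 / INR n) ltac:(lia) Hk1.
    rewrite -Estep Em => /(_ (Ein k.+2 ltac:(lia)) (Ein k ltac:(lia))) Hr.
    have Hs j := sample_lower f e n j f_lower.
    have [_ [h1 _]] := shoot_growth _ e n He Hs k ltac:(lia).
    have [h2 _] := Hpos k ltac:(lia).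
    have h3 := Hd k ltac:(lia).
    (* Once the recurrence of [shoot] is substituted, the products without [shoot] at [k.+1] cancel
       and the residual of [wkb] at [k.+1] remains as cofactor. *)
    have -> : casorati f n k.+1 - casorati f n k = - (shoot (sample f n) k.+1 *
       (wkb f n (INR k.+2 / INR n) + wkb f n (INR k / INR n)
          - f (INR k.+1 / INR n) * wkb f n (INR k.+1 / INR n))).
      by rewrite /casorati shoot_rec {1}/sample; ring.
    rewrite Rabs_Ropp Rabs_mult Rabs_pos_eq; last lra.
    move: h1 h2 h3 Hr; set y := shoot _ _; set v := wkb _ _ (INR k / _); set w := wkb _ _ (INR k.+1 / _).
    set Q := C / INR n ^ 2; move=> h1 h2 h3 Hr.
    have HQ : 0 <= Q by apply: Rdiv_le_0_compat => //; apply: pow_lt.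
    apply: (Rle_trans _ (y * (Q * v))).
      apply: Rmult_le_compat_l; first lra.
      by apply: Rle_trans Hr _; apply: Rmult_le_compat_l.
    have -> : y * (Q * v) = eta * (kap * (y * v)).
      by rewrite /eta /Q; field; split; lra.
    exact: Rmult_le_compat_l.
  have Hacc i : (a + i <= b)%N ->
      Rabs (casorati f n (a + i)%N - casorati f n a) <= ((1 + eta) ^ i - 1) * casorati f n a.
    elim: i => [|i IH] Hi.
      by rewrite addn0 Rminus_diag_eq // Rabs_R0 /=; lra.
    have h1 := IH ltac:(lia).
    have h2 := Hone (a + i)%N ltac:(lia).
    rewrite addnS.
    have h3 : eta * casorati f n (a + i)%N <= eta * ((1 + eta) ^ i * casorati f n a).
      apply: Rmult_le_compat_l => //.
      by move: h1; clear; split_Rabs; lra.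
    rewrite [(1 + eta) ^ i.+1]/= -/((1 + eta) ^ i).
    have -> : ((1 + eta) * (1 + eta) ^ i - 1) * casorati f n a =
      eta * ((1 + eta) ^ i * casorati f n a) + ((1 + eta) ^ i - 1) * casorati f n a by ring.
    by move: h1 h2 h3; clear; split_Rabs; lra.
  have := Hacc (b - a)%N ltac:(lia).
  rewrite subnKC; last lia.
  move=> H; apply: Rle_trans H _; apply: Rmult_le_compat_r; first lra.
  apply: Rplus_le_compat_r.
  (* At most n steps accumulate to exp(n eta), and n eta = C / (kap n). *)
  apply: (Rle_trans _ (exp eta ^ (b - a))).
    by apply: pow_incr; split; [lra|exact: exp_ineq1_le].
  rewrite -exp_pow_INR; apply: exp_le_mono.
  have -> : C / kap / INR n = INR n * eta by rewrite /eta; field; lra.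
  by apply: Rmult_le_compat_r => //; apply: le_INR; lia.
Qed.

End Piece.

(** * Limits near a jump *)

Lemma filterlim_at_left_seq (u : nat -> R) (c : R) :
  eventually (fun n => u n < c) -> is_lim_seq u c -> filterlim u eventually (at_left c).
Proof.
  move=> H1 /is_lim_seq_epsP H2 P [d Hd].
  have := H2 d (cond_pos d) => H3.
  by apply: filter_imp (filter_and _ _ H1 H3) => n [h1 h2]; apply: Hd.
Qed.

Lemma filterlim_at_right_seq (u : nat -> R) (c : R) :
  eventually (fun n => c < u n) -> is_lim_seq u c -> filterlim u eventually (at_right c).
Proof.
  move=> H1 /is_lim_seq_epsP H2 P [d Hd].
  have := H2 d (cond_pos d) => H3.
  by apply: filter_imp (filter_and _ _ H1 H3) => n [h1 h2]; apply: Hd.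
Qed.

(** Uniform in t because g gets integrated over windows shrinking to a jump. The strict inequalities
    keep the value of g at the jump out when the jump is an end of the window. *)
Definition uniformly_near (g : R -> R) (l : R) (x y : nat -> R) : Prop :=
  forall d, 0 < d -> eventually (fun n => forall t, x n < t < y n -> Rabs (g t - l) <= d).

Lemma uniformly_near_left (g : R -> R) (l c : R) (x y : nat -> R) :
  filterlim g (at_left c) (locally l) -> is_lim_seq x c ->
  eventually (fun n => y n <= c) -> uniformly_near g l x y.
Proof.
  move=> /filterlim_locally Hg /is_lim_seq_epsP Hx Hy d Hd.
  have [eta Heta] := Hg (mkposreal d Hd).
  have := Hx eta (cond_pos eta) => H.
  apply: filter_imp (filter_and _ _ Hy H) => n [h1 h2] t Ht.
  have Hb : ball c eta t by change (Rabs (t - c) < eta); split_Rabs; lra.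
  have : Rabs (g t - l) < d by apply: (Heta t Hb); lra.
  lra.
Qed.

Lemma uniformly_near_right (g : R -> R) (l c : R) (x y : nat -> R) :
  filterlim g (at_right c) (locally l) -> is_lim_seq y c ->
  eventually (fun n => c <= x n) -> uniformly_near g l x y.
Proof.
  move=> /filterlim_locally Hg /is_lim_seq_epsP Hx Hy d Hd.
  have [eta Heta] := Hg (mkposreal d Hd).
  have := Hx eta (cond_pos eta) => H.
  apply: filter_imp (filter_and _ _ Hy H) => n [h1 h2] t Ht.
  have Hb : ball c eta t by change (Rabs (t - c) < eta); split_Rabs; lra.
  have : Rabs (g t - l) < d by apply: (Heta t Hb); lra.
  lra.
Qed.

(** The factor n is absorbed by the window length, at most K / n: an integrand within d / (2 K) of
    [l] gives a scaled error of at most d / 2. *)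
Lemma scaled_RInt_lim (g : R -> R) (l K : R) (x y : nat -> R) :
  ex_RInt g 0 1 -> 0 < K ->
  eventually (fun n => 0 <= x n <= y n /\ y n <= 1 /\ INR n * (y n - x n) <= K) ->
  uniformly_near g l x y ->
  is_lim_seq (fun n => INR n * RInt g (x n) (y n) - INR n * (y n - x n) * l) 0.
Proof.
  move=> Hg HK Hxy Hn; apply/is_lim_seq_epsP => d Hd.
  have H0 : 0 < d / (2 * K) by apply: Rdiv_lt_0_compat; lra.
  apply: filter_imp (filter_and _ _ Hxy (Hn _ H0)) => n [[h1 [h2 h3]] h4].
  have Hex : ex_RInt g (x n) (y n) by apply: ex_RInt_sub01 => //; lra.
  have Hn0 := pos_INR n.
  have Hpre t : x n < t < y n -> Rabs (g t - (l + 0 * (t - 0))) <= d / (2 * K).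
    by move=> Ht; have := h4 t Ht; replace (g t - (l + 0 * (t - 0))) with (g t - l) by ring.
  have H := RInt_affine_approx g (x n) (y n) l 0 0 _ (proj2 h1) Hex Hpre.
  have -> : INR n * RInt g (x n) (y n) - INR n * (y n - x n) * l - 0 =
     INR n * (RInt g (x n) (y n) -
          (l * (y n - x n) + 0 * ((y n - 0) ^ 2 - (x n - 0) ^ 2) / 2)) by field.
  rewrite Rabs_mult Rabs_pos_eq //.
  apply: (Rle_lt_trans _ (INR n * (d / (2 * K) * (y n - x n)))); first exact: Rmult_le_compat_l.
  have : d / (2 * K) * (INR n * (y n - x n)) <= d / (2 * K) * K by apply: Rmult_le_compat_l; lra.
  have -> : d / (2 * K) * K = d / 2 by field; lra.
  lra.
Qed.

Lemma wkb_quot (f : R -> R) (n : nat) (x y : R) :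
  ex_RInt (fun t => loglam (f t)) 0 1 -> 0 <= x <= 1 -> 0 <= y <= 1 ->
  wkb f n y / wkb f n x =
  exp (- (INR n * RInt (fun t => loglam (f t)) x y + logamp (f y) - logamp (f x))).
Proof.
  move=> Hg Hx Hy; rewrite -(RInt_sub01 _ x y Hg Hx Hy) /wkb /Rdiv -exp_Ropp -exp_plus.
  by congr exp; rewrite /phase; ring.
Qed.

Lemma is_lim_seq_exp (u : nat -> R) (l : R) :
  is_lim_seq u l -> is_lim_seq (fun n => exp (u n)) (exp l).
Proof.
  apply: is_lim_seq_continuous'.
  by apply: (ex_derive_continuous (V := R_NormedModule)); auto_derive.
Qed.

Lemma is_lim_seq_bounded_over_n (u : nat -> R) (c K : R) :
  eventually (fun n => Rabs (u n - c) <= K / INR n) -> is_lim_seq u c.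
Proof.
  move=> H; apply/is_lim_seq_epsP => d Hd.
  have [N HN] := INR_unbounded (Rabs K / d).
  apply: filter_imp (filter_and _ _ H (eventually_ge N.+1)) => n [h1 h2].
  apply: Rle_lt_trans h1 _.
  have Hn : 0 < INR n by apply: lt_0_INR; lia.
  have h3 : Rabs K / d < INR n by apply: Rlt_le_trans HN _; apply: le_INR; lia.
  apply: (Rmult_lt_reg_r (INR n)) => //.
  have -> : K / INR n * INR n = K by field; lra.
  apply: Rle_lt_trans (Rle_abs K) _.
  have -> : Rabs K = d * (Rabs K / d) by field; lra.
  exact: Rmult_lt_compat_l.
Qed.

Lemma gamma_lam (a b : R) : 2 < a -> 2 < b -> gamma a b = lam b / lam a.
Proof.
  move=> Ha Hb; have := disc_pos a Ha; have := disc_pos b Hb.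
  rewrite /gamma /lam -/(disc a) -/(disc b) => *; field; lra.
Qed.

Lemma Rpower_gamma (a b t : R) : 2 < a -> 2 < b ->
  Rpower (gamma a b) t = exp (t * (loglam b - loglam a)).
Proof.
  move=> Ha Hb; rewrite gamma_lam // /Rpower /loglam ln_div //.
  - by have := lam_gt b Hb; lra.
  - by have := lam_gt a Ha; lra.
Qed.

Lemma beta_lam (a b : R) : 2 < a -> 2 < b ->
  beta a b = (lam a - / lam b) / (sqrt (disc a) * sqrt (disc b)).
Proof.
  move=> Ha Hb; have da := disc_pos a Ha; have db := disc_pos b Hb.
  have sa : 0 < sqrt (disc a) by apply: sqrt_lt_R0.
  have sb : 0 < sqrt (disc b) by apply: sqrt_lt_R0.
  rewrite /beta sqrt_mult; [|nra|nra].
  rewrite -/(disc a) -/(disc b) sqrt_mult; [|lra|lra].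
  rewrite lam_inv // /lam; field; lra.
Qed.

(* With p = lam fl, q = lam fr: t1 and fr - 1/t1 are the limits of the two ratios just after the jump. *)
Lemma jump_identity (p q sm sp : R) : 1 < p -> 1 < q -> 0 < sm -> 0 < sp ->
  sm * sm = p - / p ->
  let t1 := q + / q - / p in
  t1 * p * p * (/ (p * p) * / (q * q) * (sm / sp)) *
    ((q + / q - / t1 - / q) / (1 - / p * / p)) = (p - / q) / (sm * sp).
Proof.
  move=> Hp Hq Hsm Hsp Hs t1.
  have Hip : 0 < / p < 1.
    by split; [apply: Rinv_0_lt_compat|rewrite -Rinv_1; apply: Rinv_lt_contravar]; lra.
  have Hiq : 0 < / q by apply: Rinv_0_lt_compat; lra.
  have Ht1 : 0 < t1 by rewrite /t1; lra.
  have E1 : t1 * (q + / q - / t1 - / q) = q * (q - / p).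
    transitivity (t1 * q - 1); first by field; lra.
    by rewrite /t1; field; lra.
  have E2 : 1 - / p * / p = sm * sm / p by rewrite Hs; field; lra.
  rewrite E2.
  transitivity ((t1 * (q + / q - / t1 - / q)) * (/ (q * q) * (sm / sp)) / (sm * sm / p)).
    by field; repeat split; lra.
  by rewrite E1; field; repeat split; lra.
Qed.

Lemma is_lim_seq_opp' (u : nat -> R) (l : R) :
  is_lim_seq u l -> is_lim_seq (fun n => - u n) (- l).
Proof. by move=> H; apply/(is_lim_seq_opp u l). Qed.

Lemma is_lim_seq_val (u : nat -> R) (l l' : R) : l = l' -> is_lim_seq u l -> is_lim_seq u l'.
Proof. by move=> ->. Qed.

Lemma INR_addn (a b : nat) : INR (a + b)%N = INR a + INR b.
Proof. by rewrite -plus_INR. Qed.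

Lemma INR_subn (a b : nat) : (b <= a)%N -> INR (a - b)%N = INR a - INR b.
Proof. by move=> H; rewrite -{2}(subnK H) INR_addn; ring. Qed.

Lemma is_lim_seq_inv' (u : nat -> R) (l : R) :
  is_lim_seq u l -> l <> 0 -> is_lim_seq (fun n => / u n) (/ l).
Proof. by move=> H Hl; apply: (is_lim_seq_inv u l H) => -[]. Qed.

Lemma shoot_pos (f : R -> R) (e : R) (n k : nat) :
  unif_lower f e -> (0 < k <= n.+1)%N -> 0 < shoot (sample f n) k.
Proof.
  move=> Hf; case: k => // k Hk.
  have Hs j := sample_lower f e n j Hf.
  by have [_ [h _]] := shoot_growth _ e n (proj1 Hf) Hs k ltac:(lia).
Qed.

Lemma wkb_step_lim (f : R -> R) (l : R) (x y : nat -> R) : 2 < l ->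
  ex_RInt (fun t => loglam (f t)) 0 1 ->
  eventually (fun n => 0 <= x n <= y n /\ y n <= 1 /\ INR n * (y n - x n) = 1) ->
  uniformly_near (fun t => loglam (f t)) (loglam l) x y ->
  is_lim_seq (fun n => f (x n)) l -> is_lim_seq (fun n => f (y n)) l ->
  is_lim_seq (fun n => wkb f n (y n) / wkb f n (x n)) (/ lam l).
Proof.
  move=> Hl Hi Hxy Hu Hx Hy.
  have HA := scaled_RInt_lim _ _ 1 x y Hi Rlt_0_1 _ Hu.
  have {}HA : is_lim_seq (fun n => INR n * RInt (fun t => loglam (f t)) (x n) (y n)
      - INR n * (y n - x n) * loglam l) 0.
    by apply: HA; apply: filter_imp Hxy => n; lra.
  have Hb u : is_lim_seq (fun n => f (u n)) l -> is_lim_seq (fun n => logamp (f (u n))) (logamp l).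
    by apply: is_lim_seq_continuous'; apply: continuous_logamp.
  apply: (is_lim_seq_val _ (exp (- (0 + loglam l + logamp l - logamp l)))).
    by rewrite -[in RHS]exp_loglam // -exp_Ropp; congr exp; ring.
  apply: (is_lim_seq_ext_loc (fun n => exp (- (INR n * RInt (fun t => loglam (f t)) (x n) (y n)
      - INR n * (y n - x n) * loglam l + loglam l + logamp (f (y n)) - logamp (f (x n)))))).
    apply: filter_imp Hxy => n [h1 [h2 h3]].
    by rewrite wkb_quot //; try lra; congr exp; rewrite h3; ring.
  apply: is_lim_seq_exp; apply: is_lim_seq_opp'; apply: is_lim_seq_minus'; last exact: Hb.
  apply: is_lim_seq_plus'; last exact: Hb.
  by apply: is_lim_seq_plus' => //; exact: is_lim_seq_const.
Qed.

Lemma is_lim_seq_neq0 (u : nat -> R) (l : R) :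
  is_lim_seq u l -> l <> 0 -> eventually (fun n => u n <> 0).
Proof.
  move=> /is_lim_seq_epsP H Hl.
  apply: filter_imp (H _ (Rabs_pos_lt _ Hl)) => n Hn Z.
  by move: Hn; rewrite Z Rminus_0_l Rabs_Ropp; lra.
Qed.

(** * The Casoratian across one jump *)

Section Jump.

Variables (f : R -> R) (e c fl fr : R) (m : nat -> nat).
Hypothesis f_lower : unif_lower f e.
Hypothesis f_int : ex_RInt (fun t => loglam (f t)) 0 1.
Hypothesis c_unit : 0 < c <= 1.
Hypothesis f_left : filterlim f (at_left c) (locally fl).
Hypothesis f_right : filterlim f (at_right c) (locally fr).
Hypothesis fl_lower : 2 + e <= fl.
Hypothesis fr_lower : 2 + e <= fr.
(** Closed at both ends, so as to cover both conventions at a jump: the floor of n c, and its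
    ceiling minus one. *)
Hypothesis m_frac : forall n, 0 <= INR n * c - INR (m n) <= 1.
Hypothesis m_left : is_lim_seq (fun n => sample f n (m n)) fl.
Hypothesis m_right : is_lim_seq (fun n => sample f n (m n).+1) fr.

Let pos_left (i n : nat) : R := INR (m n - i)%N / INR n.
Let pos_right (i n : nat) : R := INR (m n + i)%N / INR n.

Lemma jump_frac_div (n : nat) : (0 < n)%N ->
  c - / INR n <= INR (m n) / INR n <= c.
Proof.
  move=> Hn; have Hn' : 0 < INR n by apply: lt_0_INR; lia.
  have Hin : 0 < / INR n by apply: Rinv_0_lt_compat.
  have [h1 h2] := m_frac n.
  have E : INR n * / INR n = 1 by field; lra.
  by split; apply: (Rmult_le_reg_r (INR n)) => //; rewrite /Rdiv ?Rmult_minus_distr_r Rmult_assoc Rinv_l; nra.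
Qed.

Lemma is_lim_seq_inv_INR : is_lim_seq (fun n => / INR n) 0.
Proof.
  apply: (is_lim_seq_bounded_over_n _ _ 1).
  apply: filter_imp (eventually_ge 1) => n Hn.
  have Hn' : 0 < INR n by apply: lt_0_INR; lia.
  have Hin : 0 < / INR n by apply: Rinv_0_lt_compat.
  by rewrite Rminus_0_r Rabs_pos_eq; lra.
Qed.

Lemma jump_index_large (i : nat) : eventually (fun n => (i < m n)%N).
Proof.
  have [N HN] := INR_unbounded ((INR i + 2) / c).
  exists N => n /leP Hn.
  have h1 : (INR i + 2) / c < INR n by apply: Rlt_le_trans HN _; apply: le_INR; lia.
  have h3 : (INR i + 2) / c * c = INR i + 2 by field; lra.
  have h5 : INR i + 2 < INR n * c by rewrite -h3; apply: Rmult_lt_compat_r; lra.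
  by apply/ltP/INR_lt; have := m_frac n; lra.
Qed.

Lemma jump_pos_lim : is_lim_seq (fun n => INR (m n) / INR n) c.
Proof.
  apply: (is_lim_seq_bounded_over_n _ _ 1).
  apply: filter_imp (eventually_ge 1) => n Hn.
  have := jump_frac_div n ltac:(lia).
  by move=> ?; split_Rabs; lra.
Qed.

Lemma pos_left_lim (i : nat) : is_lim_seq (pos_left i) c.
Proof.
  apply: (is_lim_seq_ext_loc (fun n => INR (m n) / INR n - INR i * / INR n)).
    apply: filter_imp (jump_index_large i) => n Hn.
    by rewrite /pos_left INR_subn; [rewrite /Rdiv; ring|lia].
  apply: (is_lim_seq_val _ (c - INR i * 0)); first ring.
  apply: is_lim_seq_minus'; first exact: jump_pos_lim.
  by apply: is_lim_seq_mult'; [exact: is_lim_seq_const|exact: is_lim_seq_inv_INR].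
Qed.

Lemma pos_right_lim (i : nat) : is_lim_seq (pos_right i) c.
Proof.
  apply: (is_lim_seq_ext (fun n => INR (m n) / INR n + INR i * / INR n)).
    by move=> n; rewrite /pos_right INR_addn /Rdiv; ring.
  apply: (is_lim_seq_val _ (c + INR i * 0)); first ring.
  apply: is_lim_seq_plus'; first exact: jump_pos_lim.
  by apply: is_lim_seq_mult'; [exact: is_lim_seq_const|exact: is_lim_seq_inv_INR].
Qed.

Lemma pos_left_lt (i : nat) : (0 < i)%N -> eventually (fun n => pos_left i n < c).
Proof.
  move=> Hi; apply: filter_imp (filter_and _ _ (eventually_ge 1) (jump_index_large i)) => n [Hn Hm].
  have Hn' : 0 < INR n by apply: lt_0_INR; lia.
  have [_ h] := jump_frac_div n ltac:(lia); apply: Rlt_le_trans h.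
  rewrite /pos_left /Rdiv; apply: Rmult_lt_compat_r; first exact: Rinv_0_lt_compat.
  by apply: lt_INR; lia.
Qed.

Lemma pos_right_gt (i : nat) : (1 < i)%N -> eventually (fun n => c < pos_right i n).
Proof.
  move=> Hi; apply: filter_imp (eventually_ge 1) => n Hn.
  have Hn' : 0 < INR n by apply: lt_0_INR; lia.
  have [h1 _] := jump_frac_div n ltac:(lia).
  have : INR (m n) / INR n + / INR n < pos_right i n; last lra.
  have -> : INR (m n) / INR n + / INR n = INR (m n).+1 / INR n by rewrite S_INR; field; lra.
  rewrite /pos_right /Rdiv; apply: Rmult_lt_compat_r; first exact: Rinv_0_lt_compat.
  by apply: lt_INR; lia.
Qed.

Lemma sample_left_lim (i : nat) : is_lim_seq (fun n => sample f n (m n - i)%N) fl.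
Proof.
  (* At shift 0 the sample point may be [c] itself, about which the one-sided limit says nothing;
     [m_left] settles it. On the right, [m_right] plays the same part at shift 1. *)
  case: i => [|i]; first by apply: is_lim_seq_ext m_left => n; rewrite subn0.
  apply: (filterlim_comp _ _ _ (pos_left i.+1) f _ (at_left c)) f_left.
  by apply: filterlim_at_left_seq; [exact: pos_left_lt|exact: pos_left_lim].
Qed.

Lemma sample_right_lim (i : nat) : (0 < i)%N -> is_lim_seq (fun n => sample f n (m n + i)%N) fr.
Proof.
  case: i => [//|[|i]] _; first by apply: is_lim_seq_ext m_right => n; rewrite addn1.
  apply: (filterlim_comp _ _ _ (pos_right i.+2) f _ (at_right c)) f_right.
  by apply: filterlim_at_right_seq; [exact: pos_right_gt|exact: pos_right_lim].
Qed.

Lemma near_index_jump : near_index f fl m.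
Proof.
  split; last by split; [exact: jump_index_large|exact: sample_left_lim].
  move=> n; apply/leP/INR_le; have := m_frac n; have := pos_INR n; nra.
Qed.

Let L t := loglam (f t).

Lemma loglam_left : filterlim L (at_left c) (locally (loglam fl)).
Proof.
  apply: (filterlim_comp _ _ _ f loglam _ _ _ f_left).
  by apply: continuous_loglam; have := proj1 f_lower; lra.
Qed.

Lemma loglam_right : filterlim L (at_right c) (locally (loglam fr)).
Proof.
  apply: (filterlim_comp _ _ _ f loglam _ _ _ f_right).
  by apply: continuous_loglam; have := proj1 f_lower; lra.
Qed.

Let Q n k := shoot_ratio (sample f n) k.

Lemma ratio_at_jump (i : nat) : is_lim_seq (fun n => Q n (m n - i)%N) (lam fl).
Proof.
  apply: (shoot_ratio_lim f e fl (fun n => (m n - i)%N) f_lower fl_lower).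
  elim: i => [|i IH].
    by have [h1 [h2 h3]] := near_index_jump; split; [|split] => [n|j|j];
       [rewrite subn0|apply: filter_imp (h2 j) => n; rewrite subn0|
        apply: is_lim_seq_ext (h3 j) => n; rewrite subn0].
  have [h1 [h2 h3]] := near_index_pred _ _ _ IH.
  split; [|split] => [n|j|j].
  - by have := h1 n; rewrite subnS.
  - by apply: filter_imp (h2 j) => n; rewrite subnS.
  - by apply: is_lim_seq_ext (h3 j) => n; rewrite subnS.
Qed.

Hypothesis c_lt1 : c < 1.

Lemma jump_index_room : eventually (fun n => (0 < n)%N /\ (5 < m n)%N /\ (m n + 5 <= n)%N).
Proof.
  have [N1 HN1] := INR_unbounded (7 / c).
  have [N2 HN2] := INR_unbounded (6 / (1 - c)).
  exists (N1 + N2).+1 => n /leP Hn.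
  have h1 : 7 / c < INR n by apply: Rlt_le_trans HN1 _; apply: le_INR; lia.
  have h2 : 6 / (1 - c) < INR n by apply: Rlt_le_trans HN2 _; apply: le_INR; lia.
  have h3 : 7 / c * c = 7 by field; lra.
  have h4 : 6 / (1 - c) * (1 - c) = 6 by field; lra.
  have h5 : 7 < INR n * c by rewrite -h3; apply: Rmult_lt_compat_r; lra.
  have h6 : 6 < INR n * (1 - c) by rewrite -h4; apply: Rmult_lt_compat_r; lra.
  have h7 := m_frac n.
  split; first by lia.
  split; first by apply/ltP/INR_lt; rewrite (_ : INR 5 = 5); [lra|rewrite /=; ring].
  by apply/leP/INR_le; rewrite INR_addn (_ : INR 5 = 5); [lra|rewrite /=; ring].
Qed.

(** [A] and [B] are the errors made when f is replaced by the constants [fl] and [fr] in the scaled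
    phase integrals on the two sides of the jump. *)
Let A n := INR n * RInt L (pos_left 2 n) c - INR n * (c - pos_left 2 n) * loglam fl.
Let B n := INR n * RInt L c (pos_right 2 n) - INR n * (pos_right 2 n - c) * loglam fr.

Lemma jump_pos_E : eventually (fun n =>
  0 < pos_left 2 n /\ pos_left 2 n < pos_left 1 n /\ pos_left 1 n < c /\
  c < pos_right 2 n /\ pos_right 2 n < pos_right 3 n /\ pos_right 3 n < 1 /\
  INR n * (pos_left 1 n - pos_left 2 n) = 1 /\ INR n * (pos_right 3 n - pos_right 2 n) = 1 /\
  INR n * (c - pos_left 2 n) = 2 + (INR n * c - INR (m n)) /\
  INR n * (pos_right 2 n - c) = 2 - (INR n * c - INR (m n))).
Proof.
  have Hl := pos_left_lt 1 isT; have Hr := pos_right_gt 2 isT.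
  apply: filter_imp (filter_and _ _ jump_index_room (filter_and _ _ Hl Hr)) => n [[Hn [Hm1 Hm2]] [h1 h2]].
  have Hn' : 0 < INR n by apply: lt_0_INR; lia.
  have Hin : 0 < / INR n by apply: Rinv_0_lt_compat.
  have Hlt a b : (a < b)%N -> INR a / INR n < INR b / INR n.
    by move=> Hab; apply: Rmult_lt_compat_r => //; apply: lt_INR; lia.
  split; first by rewrite -[0](Rmult_0_l (/ INR n)); apply: (Hlt 0%N); lia.
  split; first by apply: Hlt; lia.
  split=> //; split=> //.
  split; first by apply: Hlt; lia.
  split.
    have -> : 1 = INR n / INR n by field; lra.
    by apply: Hlt; lia.
  rewrite /pos_left /pos_right !INR_addn !INR_subn; try lia.
  rewrite (_ : INR 1 = 1) // (_ : INR 2 = 2) // (_ : INR 3 = 3); last by rewrite /=; ring.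
  by repeat split; field; lra.
Qed.

(** With theta = n c - m, the window covers 2 + theta steps left of c and 2 - theta right of it. The
    phase factor is thus asymptotically lam(fl)^(-2-theta) lam(fr)^(-2+theta), in which theta enters
    exactly as gamma^theta. As theta need not converge, this power is divided out first. *)
Lemma jump_wkb_across :
  is_lim_seq (fun n => wkb f n (pos_right 2 n) / wkb f n (pos_left 2 n) /
                       Rpower (gamma fl fr) (INR n * c - INR (m n)))
    (/ (lam fl * lam fl) * / (lam fr * lam fr) * (sqrt (disc fl) / sqrt (disc fr))).
Proof.
  have He := proj1 f_lower.
  have HA : is_lim_seq A 0.
    apply: (scaled_RInt_lim L (loglam fl) 3 (pos_left 2) (fun=> c)) => //; first lra.
      apply: filter_imp jump_pos_E => n; have := m_frac n; lra.
    apply: uniformly_near_left loglam_left (pos_left_lim 2) _.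
    by apply: filter_imp (eventually_ge 0) => n _; lra.
  have HB : is_lim_seq B 0.
    apply: (scaled_RInt_lim L (loglam fr) 3 (fun=> c) (pos_right 2)) => //; first lra.
      apply: filter_imp jump_pos_E => n; have := m_frac n; lra.
    apply: uniformly_near_right loglam_right (pos_right_lim 2) _.
    by apply: filter_imp (eventually_ge 0) => n _; lra.
  have Hb1 : is_lim_seq (fun n => logamp (f (pos_left 2 n))) (logamp fl).
    by apply: is_lim_seq_continuous' (sample_left_lim 2); apply: continuous_logamp; lra.
  have Hb2 : is_lim_seq (fun n => logamp (f (pos_right 2 n))) (logamp fr).
    by apply: is_lim_seq_continuous' (sample_right_lim 2 isT); apply: continuous_logamp; lra.
  have -> : / (lam fl * lam fl) * / (lam fr * lam fr) * (sqrt (disc fl) / sqrt (disc fr))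
    = exp (- (0 + 0 + 2 * loglam fl + 2 * loglam fr + logamp fr - logamp fl)).
    rewrite -!exp_logamp -?exp_loglam; try lra.
    rewrite /Rdiv -!exp_plus -!exp_Ropp -!exp_plus; congr exp; ring.
  apply: (is_lim_seq_ext_loc (fun n => exp (- (A n + B n + 2 * loglam fl + 2 * loglam fr
       + logamp (f (pos_right 2 n)) - logamp (f (pos_left 2 n)))))).
    apply: filter_imp jump_pos_E => n [h1 [h2 [h3 [h4 [h5 [h6 [_ [_ [h7 h8]]]]]]]]].
    rewrite wkb_quot //; [|lra|lra].
    rewrite Rpower_gamma; [|lra|lra].
    rewrite /Rdiv -exp_Ropp -exp_plus; congr exp.
    rewrite -(RInt_Chasles _ _ c); try (apply: ex_RInt_sub01 => //; lra).
    rewrite /plus /= /A /B h7 h8 /L; ring.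
  apply: is_lim_seq_exp; apply: is_lim_seq_opp'.
  apply: is_lim_seq_minus' => //; apply: is_lim_seq_plus' => //.
  do 2 (apply: is_lim_seq_plus'; last exact: is_lim_seq_const).
  exact: is_lim_seq_plus'.
Qed.


(** Just beyond the jump the ratios have not yet settled near [lam fr]; over a fixed number of steps
    the exact recursion passes to the limit, without contraction. *)
Lemma ratio_after_jump (i : nat) (t : R) : 0 < t -> (0 < i)%N ->
  is_lim_seq (fun n => Q n (m n + i).-1) t ->
  is_lim_seq (fun n => Q n (m n + i)%N) (fr - / t).
Proof.
  move=> Ht Hi Hlim.
  apply: (is_lim_seq_ext_loc (fun n => sample f n (m n + i)%N - / Q n (m n + i).-1)).
    have Hr : eventually (fun n => (m n + i <= n)%N).
      have [N HN] := INR_unbounded (INR i / (1 - c)).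
      exists N => n /leP Hn.
      have h1 : INR i / (1 - c) < INR n by apply: Rlt_le_trans HN _; apply: le_INR; lia.
      have h4 : INR i / (1 - c) * (1 - c) = INR i by field; lra.
      have h6 : INR i < INR n * (1 - c) by rewrite -h4; apply: Rmult_lt_compat_r; lra.
      by apply/leP/INR_le; rewrite INR_addn; have := m_frac n; lra.
    apply: filter_imp (filter_and _ _ Hr jump_index_room) => n [h1 [h2 [h3 _]]].
    have Hs j := sample_lower f e n j f_lower.
    by rewrite /Q -(shoot_ratio_rec _ e n (proj1 f_lower) Hs) //; lia.
  by apply: is_lim_seq_minus'; [exact: sample_right_lim|apply: is_lim_seq_inv' => //; lra].
Qed.

(** Neither [shoot] nor [wkb] converges separately, so everything is expressed by ratios: [lam fl]
    up to index m, then [t1] and fr - 1 / t1 at the next two indices. [jump_identity] recognises the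
    resulting rational expression as beta. *)
Lemma jump_casorati :
  is_lim_seq (fun n => casorati f n (m n + 2) /
      (casorati f n (m n - 2) * Rpower (gamma fl fr) (INR n * c - INR (m n)))) (beta fl fr).
Proof.
  have He := proj1 f_lower.
  have Hp := lam_gt fl ltac:(lra); have Hq := lam_gt fr ltac:(lra).
  have Hip : / lam fl < 1 by rewrite -Rinv_1; apply: Rinv_lt_contravar; lra.
  have Hip0 : 0 < / lam fl by apply: Rinv_0_lt_compat; lra.
  have Hiq0 : 0 < / lam fr by apply: Rinv_0_lt_compat; lra.
  have Hfr := lam_add_inv fr ltac:(lra).
  set t1 := fr - / lam fl.
  have Ht1 : 0 < t1 by rewrite /t1; lra.
  have Q0 : is_lim_seq (fun n => Q n (m n)) (lam fl).
    by apply: is_lim_seq_ext (ratio_at_jump 0) => n; rewrite subn0.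
  have Q1 : is_lim_seq (fun n => Q n (m n + 1)%N) t1.
    apply: ratio_after_jump => //; first lra.
    by apply: is_lim_seq_ext Q0 => n; rewrite addn1.
  have Q2 : is_lim_seq (fun n => Q n (m n + 2)%N) (fr - / t1).
    apply: ratio_after_jump => //.
    by apply: is_lim_seq_ext Q1 => n; rewrite addn2 addn1.
  have Rl : is_lim_seq (fun n => wkb f n (pos_left 1 n) / wkb f n (pos_left 2 n)) (/ lam fl).
    apply: wkb_step_lim => //; first lra.
    - by apply: filter_imp jump_pos_E => n; lra.
    - apply: uniformly_near_left loglam_left (pos_left_lim 2) _.
      by apply: filter_imp jump_pos_E => n; lra.
    - exact: (sample_left_lim 2).
    - exact: (sample_left_lim 1).
  have Rr : is_lim_seq (fun n => wkb f n (pos_right 3 n) / wkb f n (pos_right 2 n)) (/ lam fr).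
    apply: wkb_step_lim => //; first lra.
    - by apply: filter_imp jump_pos_E => n; lra.
    - apply: uniformly_near_right loglam_right (pos_right_lim 3) _.
      by apply: filter_imp jump_pos_E => n; lra.
    - exact: (sample_right_lim 2).
    - exact: (sample_right_lim 3).
  have Hsm : 0 < sqrt (disc fl) by apply/sqrt_lt_R0/disc_pos; lra.
  have Hsp : 0 < sqrt (disc fr) by apply/sqrt_lt_R0/disc_pos; lra.
  have Hsq : sqrt (disc fl) * sqrt (disc fl) = lam fl - / lam fl.
    by rewrite sqrt_sqrt ?lam_sub_inv //; [lra|apply/Rlt_le/disc_pos; lra].
  have Hden : 1 - / lam fl * / lam fl <> 0.
    have : / lam fl * / lam fl < 1 * 1 by apply: Rmult_le_0_lt_compat; lra.
    lra.
  have HD : is_lim_seq (fun n => 1 - wkb f n (pos_left 1 n) / wkb f n (pos_left 2 n)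
      * / Q n (m n - 2)%N) (1 - / lam fl * / lam fl).
    apply: is_lim_seq_minus'; first exact: is_lim_seq_const.
    apply: is_lim_seq_mult' => //.
    by apply: is_lim_seq_inv'; [exact: ratio_at_jump|lra].
  have Hid := jump_identity (lam fl) (lam fr) _ _ ltac:(lra) ltac:(lra) Hsm Hsp Hsq.
  rewrite /= Hfr -/t1 in Hid.
  rewrite beta_lam; [|lra|lra].
  apply: (is_lim_seq_val _ _ _ Hid).
  (* Each Casoratian is factored into one product of [shoot] and [wkb] times a bracket of ratios.
     The three ratios in front telescope to the quotient of [shoot] at m + 2 by [shoot] at m - 1. *)
  apply: (is_lim_seq_ext_loc (fun n =>
    (Q n (m n + 1)%N * Q n (m n) * Q n (m n - 1)%N) *
    (wkb f n (pos_right 2 n) / wkb f n (pos_left 2 n) / Rpower (gamma fl fr) (INR n * c - INR (m n))) *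
    ((Q n (m n + 2)%N - wkb f n (pos_right 3 n) / wkb f n (pos_right 2 n)) /
     (1 - wkb f n (pos_left 1 n) / wkb f n (pos_left 2 n) * / Q n (m n - 2)%N)))).
    have Hnz := is_lim_seq_neq0 _ _ HD Hden.
    apply: filter_imp (filter_and _ _ Hnz jump_index_room) => n [Hz [h2 [h3 h4]]].
    move: Hz; rewrite /Q /pos_left /pos_right /casorati /shoot_ratio.
    have [k Ek] : exists k, m n = k.+3 by exists (m n - 3)%N; lia.
    have -> : (m n + 1)%N = k.+4 by lia.
    have -> : (m n + 2)%N = k.+4.+1 by lia.
    have -> : (m n + 3)%N = k.+4.+2 by lia.
    have -> : (m n - 1)%N = k.+2 by lia.
    have -> : (m n - 2)%N = k.+1 by lia.
    rewrite Ek.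
    have Y1 := shoot_pos f e n k.+1 f_lower ltac:(lia).
    have Y2 := shoot_pos f e n k.+2 f_lower ltac:(lia).
    have Y3 := shoot_pos f e n k.+3 f_lower ltac:(lia).
    have Y4 := shoot_pos f e n k.+4 f_lower ltac:(lia).
    have Y5 := shoot_pos f e n k.+4.+1 f_lower ltac:(lia).
    have P1 := wkb_pos f n (INR k.+1 / INR n).
    have P2 := wkb_pos f n (INR k.+4.+1 / INR n).
    have P3 : 0 < Rpower (gamma fl fr) (INR n * c - INR k.+3) by exact: exp_pos.
    move: P1 P2 P3 Y1 Y2 Y3 Y4 Y5.
    move: (shoot _ k.+4.+2) (shoot _ k.+4.+1) (shoot _ k.+4) (shoot _ k.+3) (shoot _ k.+2) (shoot _ k.+1)
      (Rpower _ _) (wkb _ _ (INR k.+1 / _)) (wkb _ _ (INR k.+2 / _)) (wkb _ _ (INR k.+4.+1 / _))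
      (wkb _ _ (INR k.+4.+2 / _)).
    move=> y6 y5 y4 y3 y2 y1 P w1 w2 w5 w6 P1 P2 P3 Y1 Y2 Y3 Y4 Y5 Hz.
    have E : 1 - w2 / w1 * / (y2 / y1) = (y2 * w1 - y1 * w2) / (y2 * w1) by field; lra.
    have Hz' : y2 * w1 - y1 * w2 <> 0.
      by move=> Z; apply: Hz; rewrite E Z /Rdiv Rmult_0_l.
    by field; repeat split; try lra.
  apply: is_lim_seq_mult'.
    apply: is_lim_seq_mult'; last exact: jump_wkb_across.
    by apply: is_lim_seq_mult'; [exact: is_lim_seq_mult'|exact: ratio_at_jump].
  by apply: is_lim_seq_div' => //; apply: is_lim_seq_minus'.
Qed.

End Jump.

(** * The right end point *)

Lemma Gf_pow (f : R -> R) (n : nat) :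
  Gf f ^ n = exp (INR n * RInt (fun t => loglam (f t)) 0 1).
Proof. by rewrite exp_pow_INR. Qed.

(** The right end behaves like the left half of a jump at c = 1 with [m] the identity, so theta = 0.
    The limit simplifies because 1 - 1 / p^2 = disc(f 1) / p for p = lam(f 1). *)
Lemma end_casorati (f : R -> R) (e : R) :
  unif_lower f e -> ex_RInt (fun t => loglam (f t)) 0 1 ->
  filterlim f (at_left 1) (locally (f 1)) ->
  is_lim_seq (fun n => Dn f n / Gf f ^ n / casorati f n (n - 1)) (lam (f 1) / sqrt (disc (f 1))).
Proof.
  move=> Hf Hi Hl; have He := proj1 Hf.
  have H1 := proj2 Hf 1 ltac:(lra).
  have Hfrac n : 0 <= INR n * 1 - INR n <= 1 by lra.
  have Hm : is_lim_seq (fun n => sample f n n) (f 1).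
    apply: (is_lim_seq_ext_loc (fun=> f 1)); last exact: is_lim_seq_const.
    apply: filter_imp (eventually_ge 1) => n Hn.
    by rewrite /sample; congr f; field; apply: not_0_INR; lia.
  have Hp := lam_gt (f 1) ltac:(lra).
  have Hd := disc_pos (f 1) ltac:(lra).
  have Hsub := lam_sub_inv (f 1) ltac:(lra).
  set p := lam (f 1) in Hp Hsub *.
  have Hip : / p < 1 by rewrite -Rinv_1; apply: Rinv_lt_contravar; lra.
  have Hip0 : 0 < / p by apply: Rinv_0_lt_compat; lra.
  have Hden : 1 - / p * / p <> 0.
    have : / p * / p < 1 * 1 by apply: Rmult_le_0_lt_compat; lra.
    lra.
  have Q0 : is_lim_seq (fun n => shoot_ratio (sample f n) (n - 0)) p.
    by apply: (ratio_at_jump f e 1 (f 1) id) => //; lra.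
  have Q1 : is_lim_seq (fun n => shoot_ratio (sample f n) (n - 1)) p.
    by apply: (ratio_at_jump f e 1 (f 1) id) => //; lra.
  have Hx1 : is_lim_seq (fun n => INR (n - 1) / INR n) 1.
    by apply: (pos_left_lim 1 id) => //; lra.
  have Hr : is_lim_seq (fun n => wkb f n 1 / wkb f n (INR (n - 1) / INR n)) (/ p).
    apply: (wkb_step_lim f (f 1) _ (fun=> 1)) => //; first lra.
    - apply: filter_imp (eventually_ge 1) => n Hn.
      have Hn' : 0 < INR n by apply: lt_0_INR; lia.
      have Hin : 0 < / INR n by apply: Rinv_0_lt_compat.
      have E : INR (n - 1) / INR n = 1 - / INR n.
        by rewrite INR_subn // (_ : INR 1 = 1) //; field; lra.
      have : 0 <= INR (n - 1) / INR n by apply: Rdiv_le_0_compat => //; exact: pos_INR.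
      by rewrite E => ?; repeat split; try lra; field; lra.
    - apply: uniformly_near_left Hx1 _; last by apply: filter_imp (eventually_ge 0) => n _; lra.
      by apply: (loglam_left f e 1 (f 1)) => //; lra.
    - by apply: (sample_left_lim f 1 (f 1) id _ _ _ _ 1) => //; lra.
    - exact: is_lim_seq_const.
  have HD : is_lim_seq (fun n => 1 - wkb f n 1 / wkb f n (INR (n - 1) / INR n)
      * / shoot_ratio (sample f n) (n - 1)) (1 - / p * / p).
    apply: is_lim_seq_minus'; first exact: is_lim_seq_const.
    by apply: is_lim_seq_mult' => //; apply: is_lim_seq_inv' => //; lra.
  have Hs : 0 < sqrt (disc (f 1)) by apply: sqrt_lt_R0.
  apply: (is_lim_seq_val _ (p * sqrt (disc (f 1)) * (/ p / (1 - / p * / p)))).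
    have -> : 1 - / p * / p = sqrt (disc (f 1)) * sqrt (disc (f 1)) / p.
      by rewrite sqrt_sqrt ?Hsub; [rewrite -Hsub; field|]; lra.
    by field; lra.
  apply: (is_lim_seq_ext_loc (fun n => shoot_ratio (sample f n) (n - 0) * sqrt (disc (f 1)) *
     (wkb f n 1 / wkb f n (INR (n - 1) / INR n) /
      (1 - wkb f n 1 / wkb f n (INR (n - 1) / INR n) * / shoot_ratio (sample f n) (n - 1))))); last first.
    apply: is_lim_seq_mult'; last exact: is_lim_seq_div'.
    by apply: is_lim_seq_mult' => //; exact: is_lim_seq_const.
  apply: filter_imp (filter_and _ _ (is_lim_seq_neq0 _ _ HD Hden) (eventually_ge 2)) => n [].
  case: n => [|[|k]] // Hz _; move: Hz.
  have -> : (k.+2 - 1)%N = k.+1 by lia.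
  rewrite subn0 /casorati Dn_shoot Gf_pow /shoot_ratio.
  have -> : INR k.+2 / INR k.+2 = 1 by field; apply: not_0_INR.
  have Y1 := shoot_pos f e k.+2 k.+1 Hf ltac:(lia).
  have Y2 := shoot_pos f e k.+2 k.+2 Hf ltac:(lia).
  have Y3 := shoot_pos f e k.+2 k.+3 Hf ltac:(lia).
  have P1 := wkb_pos f k.+2 (INR k.+1 / INR k.+2).
  have P2 := wkb_pos f k.+2 1.
  (* [Gf f ^ n] and [wkb] at 1 contain the same phase integral with opposite signs; only the
     amplitude at 1 is left over. *)
  have -> : exp (INR k.+2 * RInt (fun t : R => loglam (f t)) 0 1) = / (wkb f k.+2 1 * sqrt (disc (f 1))).
    rewrite /wkb /phase -exp_logamp; last lra.
    by rewrite -exp_plus -exp_Ropp; congr exp; ring.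
  move: P1 P2 Y1 Y2 Y3 Hs.
  move: (shoot _ k.+3) (shoot _ k.+2) (shoot _ k.+1) (wkb _ _ (INR k.+1 / _)) (wkb _ _ 1) (sqrt _).
  move=> y3 y2 y1 w1 w2 s P1 P2 Y1 Y2 Y3 Hs Hz.
  have E : 1 - w2 / w1 * / (y2 / y1) = (y2 * w1 - y1 * w2) / (y2 * w1) by field; lra.
  have Hz' : y2 * w1 - y1 * w2 <> 0.
    by move=> Z; apply: Hz; rewrite E Z /Rdiv Rmult_0_l.
  by field; repeat split; try lra.
Qed.

(** * Assembling the pieces *)

Lemma filterlim_gt_le (F : (R -> Prop) -> Prop) (g : R -> R) (l b : R) {FF : ProperFilter F} :
  filterlim g F (locally l) -> F (fun x => b < g x) -> b <= l.
Proof.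
  move=> /filterlim_locally Hg Hb; apply: Rnot_lt_le => Hl.
  have Hd : 0 < b - l by lra.
  have [x [h1 h2]] := filter_ex _ (filter_and _ _ Hb (Hg (mkposreal _ Hd))).
  have : Rabs (g x - l) < b - l := h2.
  by split_Rabs; lra.
Qed.

(** The integral ignores the end point values, so g may be replaced by the continuous extension of
    its restriction to the open interval. *)
Lemma ex_RInt_open (g : R -> R) (a b la lb : R) : a < b ->
  (forall x, a < x < b -> continuous g x) ->
  filterlim g (at_right a) (locally la) -> filterlim g (at_left b) (locally lb) ->
  ex_RInt g a b.
Proof.
  move=> Hab Hc Ha Hb.
  have [h [h1 [h2 _]]] := C0_extension_lt g la lb a b Hab Hc Ha Hb.
  apply: (ex_RInt_ext h).
    by move=> x; rewrite Rmin_left ?Rmax_right; [exact: h2|lra|lra].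
  by apply: (ex_RInt_continuous (V := R_CompleteNormedModule)) => z _; exact: h1.
Qed.

Lemma prodR0 (F : nat -> R) : (\prod_(i < 0) F i)%R = 1 :> R.
Proof. by rewrite big_ord0. Qed.

Lemma prodR_recr (F : nat -> R) (k : nat) :
  (\prod_(i < k.+1) F i)%R = (\prod_(i < k) F i)%R * F k :> R.
Proof. by rewrite big_ord_recr. Qed.

Lemma prodR_mul (F G : nat -> R) (k : nat) :
  (\prod_(i < k) (F i * G i))%R = (\prod_(i < k) F i)%R * (\prod_(i < k) G i)%R :> R.
Proof. exact: big_split. Qed.

Lemma prodR_pos (F : nat -> R) (k : nat) : (forall i, (i < k)%N -> 0 < F i) -> 0 < (\prod_(i < k) F i)%R.
Proof.
  elim: k => [|k IH] H; first by rewrite prodR0; lra.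
  rewrite prodR_recr; apply: Rmult_lt_0_compat; last exact: H.
  by apply: IH => i Hi; apply: H; lia.
Qed.

Lemma prodR_le (F G : nat -> R) (k : nat) : (forall i, (i < k)%N -> 0 < F i <= G i) ->
  (\prod_(i < k) F i)%R <= (\prod_(i < k) G i)%R.
Proof.
  elim: k => [|k IH] H; first by rewrite !prodR0; lra.
  have H' i : (i < k)%N -> 0 < F i <= G i by move=> Hi; apply: H; lia.
  rewrite !prodR_recr; have := H k (ltnSn k) => ?.
  have hp : 0 < (\prod_(i < k) F i)%R by apply: prodR_pos => i Hi; case: (H' i Hi).
  by apply: Rmult_le_compat; [lra|lra|exact: IH|lra].
Qed.

(** * Pieces between consecutive jumps *)

Section PiecewiseSmooth.

Variables (f : R -> R) (r : nat) (c fl fr : nat -> R) (e : R).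
Hypothesis c_range : forall j : nat, (j < r)%N -> 0 < c j < 1.
Hypothesis c_incr : forall j : nat, (j.+1 < r)%N -> c j < c j.+1.
Hypothesis f_smooth : twice_diff_bdd (punctured r c) f.
Hypothesis f_left : forall j : nat, (j < r)%N -> filterlim f (at_left (c j)) (locally (fl j)).
Hypothesis f_right : forall j : nat, (j < r)%N -> filterlim f (at_right (c j)) (locally (fr j)).
Hypothesis f_lower : unif_lower f e.

Lemma c_lt (i j : nat) : (i < j < r)%N -> c i < c j.
Proof.
  elim: j => [|j IH] // Hij.
  have := c_incr j ltac:(lia).
  case: (ltnP i j) => Hlt; first by have := IH ltac:(lia); lra.
  by have -> : i = j by lia.
Qed.

Definition knot (j : nat) : R := if j is k.+1 then (if (k < r)%N then c k else 1) else 0.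

Lemma knot_lt (j : nat) : (j <= r)%N -> knot j < knot j.+1.
Proof.
  case: j => [|j] Hj /=.
    by case: ifP => // H; [have := c_range 0 H|]; lra.
  rewrite Hj; case: ifP => H; first by apply: c_lt; lia.
  by have := c_range j Hj; lra.
Qed.

Lemma knot_unit (j : nat) : 0 <= knot j <= 1.
Proof. by case: j => [|j] /=; [lra|case: ifP => [/c_range|]; lra]. Qed.

Lemma knot_punctured (j : nat) (x : R) : (j <= r)%N -> knot j < x < knot j.+1 -> punctured r c x.
Proof.
  move=> Hj Hx; have := knot_unit j; have := knot_unit j.+1 => h1 h2.
  split; first lra.
  move=> i Hi E; rewrite {}E in Hx.
  case: (ltnP i j) => Hij.
    have : c i <= knot j; last lra.
    case: j Hj Hx h1 h2 Hij => // j Hj _ _ _ Hij /=; rewrite Hj.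
    case: (ltnP i j) => h; first by have := c_lt i j ltac:(lia); lra.
    by have -> : (i = j); [lia|lra].
  have : knot j.+1 <= c i; last lra.
  rewrite /=; have -> : (j < r)%N by lia.
  case: (ltnP j i) => h; first by have := c_lt j i ltac:(lia); lra.
  by have -> : (i = j); [lia|lra].
Qed.

(** Closed at 0 and 1 but open at the jumps, in accordance with the points where [f_smooth] provides
    derivatives. *)
Definition piece (j : nat) (x : R) : Prop := punctured r c x /\ knot j <= x <= knot j.+1.

Lemma piece_open (j : nat) (x : R) : (j <= r)%N -> knot j < x < knot j.+1 -> piece j x.
Proof. by move=> Hj Hx; split; [apply: (knot_punctured j)|lra]. Qed.

Lemma piece_convex (j : nat) : (j <= r)%N -> convex_set (piece j).
Proof.
  move=> Hj x y t [Dx Hx] [Dy Hy] Ht.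
  case: (Req_dec t x) => [->|Hne1]; first by split.
  case: (Req_dec t y) => [->|Hne2]; first by split.
  by apply: piece_open => //; lra.
Qed.

Lemma piece0 : piece 0 0.
Proof.
  have := knot_lt 0 (leq0n r) => /= h.
  by split; [split; [lra|move=> j /c_range]|rewrite /=]; lra.
Qed.

Lemma piece1 : piece r 1.
Proof.
  have E : knot r.+1 = 1 by rewrite /= ltnn.
  have := knot_lt r (leqnn r); rewrite /piece E => h.
  by split; [split; [lra|move=> j /c_range]|]; lra.
Qed.

Lemma f_within_continuous (x : R) :
  punctured r c x -> filterlim f (within (punctured r c) (locally x)) (locally (f x)).
Proof.
  have [g1 [g2 [M [h1 _]]]] := f_smooth.
  by move=> Dx; apply: deriv_within_continuous (h1 x Dx).
Qed.

Lemma f_continuous_open (j : nat) (x : R) :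
  (j <= r)%N -> knot j < x < knot j.+1 -> continuous f x.
Proof.
  move=> Hj Hx P HP.
  have := f_within_continuous x (knot_punctured j x Hj Hx) P HP.
  rewrite /filtermap /within => -[d Hd].
  have Hm : 0 < Rmin d (Rmin (x - knot j) (knot j.+1 - x)).
    by apply: Rmin_pos; [exact: (cond_pos d)|apply: Rmin_pos; lra].
  exists (mkposreal _ Hm) => y Hy.
  have {}Hy : Rabs (y - x) < Rmin d (Rmin (x - knot j) (knot j.+1 - x)) := Hy.
  have k1 := Rmin_l d (Rmin (x - knot j) (knot j.+1 - x)).
  have k2 := Rmin_r d (Rmin (x - knot j) (knot j.+1 - x)).
  have k3 := Rmin_l (x - knot j) (knot j.+1 - x).
  have k4 := Rmin_r (x - knot j) (knot j.+1 - x).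
  apply: Hd; first by change (Rabs (y - x) < d); lra.
  by apply: (knot_punctured j) => //; split_Rabs; lra.
Qed.

Lemma f_at_right_knot (j : nat) : (j <= r)%N ->
  filterlim f (at_right (knot j)) (locally (if j is k.+1 then fr k else f 0)).
Proof.
  case: j => [|j] Hj /=; last by rewrite Hj; exact: f_right.
  have [D0 _] := piece0.
  move=> P HP; have := f_within_continuous 0 D0 P HP.
  rewrite /filtermap /within => -[d Hd].
  have := knot_lt 0 (leq0n r); rewrite [knot 0]/= => Hk.
  have Hm : 0 < Rmin d (knot 1) by apply: Rmin_pos => //; exact: (cond_pos d).
  exists (mkposreal _ Hm) => y Hy H0.
  have {}Hy : Rabs (y - 0) < Rmin d (knot 1) := Hy.
  have k1 := Rmin_l d (knot 1); have k2 := Rmin_r d (knot 1).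
  apply: Hd; first by change (Rabs (y - 0) < d); lra.
  apply: (knot_punctured 0) => //; rewrite [knot 0]/=; split_Rabs; lra.
Qed.

Lemma f_at_left_knot (j : nat) : (j <= r)%N ->
  filterlim f (at_left (knot j.+1)) (locally (if (j < r)%N then fl j else f 1)).
Proof.
  move=> Hj /=; case: ifP => Hjr; first exact: f_left.
  have E : j = r by lia.
  have [D1 _] := piece1.
  move=> P HP; have := f_within_continuous 1 D1 P HP.
  rewrite /filtermap /within => -[d Hd].
  have := knot_lt r (leqnn r); have E1 : knot r.+1 = 1 by rewrite /= ltnn.
  rewrite E1 => Hk.
  have Hm : 0 < Rmin d (1 - knot r) by apply: Rmin_pos; [exact: (cond_pos d)|lra].
  exists (mkposreal _ Hm) => y Hy H0.
  have {}Hy : Rabs (y - 1) < Rmin d (1 - knot r) := Hy.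
  have k1 := Rmin_l d (1 - knot r); have k2 := Rmin_r d (1 - knot r).
  apply: Hd; first by change (Rabs (y - 1) < d); lra.
  by apply: (knot_punctured r) => //; rewrite E1; split_Rabs; lra.
Qed.

Lemma fl_lower (j : nat) : (j < r)%N -> 2 + e <= fl j.
Proof.
  move=> Hj; apply: (filterlim_gt_le (at_left (c j)) f) (f_left j Hj) _.
  have Hc := c_range j Hj.
  exists (mkposreal _ (proj1 Hc)) => y Hy Hlt.
  have {}Hy : Rabs (y - c j) < c j := Hy.
  by apply: (proj2 f_lower); split_Rabs; lra.
Qed.

Lemma fr_lower (j : nat) : (j < r)%N -> 2 + e <= fr j.
Proof.
  move=> Hj; apply: (filterlim_gt_le (at_right (c j)) f) (f_right j Hj) _.
  have Hc := c_range j Hj.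
  have H1 : 0 < 1 - c j by lra.
  exists (mkposreal _ H1) => y Hy Hlt.
  have {}Hy : Rabs (y - c j) < 1 - c j := Hy.
  by apply: (proj2 f_lower); split_Rabs; lra.
Qed.

Lemma loglam_f_integrable : ex_RInt (fun t => loglam (f t)) 0 1.
Proof.
  have He := proj1 f_lower.
  have Hf x : 0 <= x <= 1 -> 2 < f x by move=> Hx; have := proj2 f_lower x Hx; lra.
  have Hpiece j : (j <= r)%N -> ex_RInt (fun t => loglam (f t)) (knot j) (knot j.+1).
    move=> Hj.
    apply: (ex_RInt_open _ _ _ (loglam (if j is k.+1 then fr k else f 0))
              (loglam (if (j < r)%N then fl j else f 1))); first exact: knot_lt.
    - move=> x Hx; apply: (continuous_comp f loglam); first exact: f_continuous_open Hx.
      by apply/continuous_loglam/Hf; have := knot_unit j; have := knot_unit j.+1; lra.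
    - apply: (filterlim_comp _ _ _ f loglam _ _ _ (f_at_right_knot j Hj)).
      apply: continuous_loglam; case: j Hj => [|j] Hj; first by apply: Hf; lra.
      by have := fr_lower j Hj; lra.
    - apply: (filterlim_comp _ _ _ f loglam _ _ _ (f_at_left_knot j Hj)).
      apply: continuous_loglam; case: ifP => H; last by apply: Hf; lra.
      by have := fl_lower j H; lra.
  have Hacc j : (j <= r.+1)%N -> ex_RInt (fun t => loglam (f t)) 0 (knot j).
    elim: j => [|j IH] Hj; first exact: ex_RInt_point.
    by apply: (ex_RInt_Chasles _ _ (knot j)); [apply: IH; lia|apply: Hpiece].
  by have := Hacc r.+1 (leqnn _); rewrite /= ltnn.
Qed.

Lemma piece_transport (j : nat) : (j <= r)%N -> exists C N, forall n a b,
  (N <= n)%N -> (a <= b < n)%N -> piece j (INR a / INR n) -> piece j (INR b.+1 / INR n) ->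
  0 < casorati f n a /\
  Rabs (casorati f n b - casorati f n a) <= (exp (C / INR n) - 1) * casorati f n a.
Proof.
  move=> Hj; have [g1 [g2 [M [h1 [h2 h3]]]]] := f_smooth.
  have Hk := knot_lt j Hj.
  set x0 := (knot j + knot j.+1) / 2.
  have Ex0 : piece j x0 by apply: piece_open => //; rewrite /x0; lra.
  have Hu x : piece j x -> 0 <= x <= 1 by case=> -[].
  have HD x : piece j x -> punctured r c x by case.
  have Hc := piece_convex j Hj.
  have HM : 0 <= M by have := h3 x0 (HD _ Ex0); have := Rabs_pos (g2 x0); lra.
  have Hmf := mvt_on_deriv_within _ _ f g1 Hc HD h1.
  have Hm1 := mvt_on_deriv_within _ _ g1 g2 Hc HD h2.
  have Hl1 := mvt_on_lipschitz _ _ _ M Hm1 (fun x Ex => h3 x (HD x Ex)).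
  have Hdist x : piece j x -> Rabs (x - x0) <= 1.
    by move=> Ex; have := Hu x Ex; have := Hu x0 Ex0; split_Rabs; lra.
  (* The hypothesis bounds only f''. As a piece has length at most 1, mean values from its midpoint
     [x0] bound f' by [B], and then f by |f(x0)| + [B]. *)
  set B := Rabs (g1 x0) + M.
  have HB x : piece j x -> Rabs (g1 x) <= B.
    move=> Ex; have := Hl1 x0 x Ex0 Ex.
    have : M * Rabs (x - x0) <= M * 1 by apply: Rmult_le_compat_l => //; exact: Hdist.
    by rewrite /B; clear; split_Rabs; lra.
  have HB0 : 0 <= B by have := HB x0 Ex0; have := Rabs_pos (g1 x0); lra.
  have HF x : piece j x -> f x <= Rabs (f x0) + B.
    move=> Ex; have := mvt_on_lipschitz _ _ _ B Hmf HB x0 x Ex0 Ex.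
    have : B * Rabs (x - x0) <= B * 1 by apply: Rmult_le_compat_l => //; exact: Hdist.
    by clear; split_Rabs; lra.
  have HF0 : 0 <= Rabs (f x0) + B by have := Rabs_pos (f x0); lra.
  exact: (casorati_transport f g1 e M B _ (piece j) f_lower loglam_f_integrable Hc Hu Hmf Hl1 HM HB HF0 HF).
Qed.

(** * Telescoping the Casoratian over all pieces and jumps *)

Variable m : nat -> nat -> nat.
Hypothesis m_frac : forall j n, (j < r)%N -> 0 <= INR n * c j - INR (m j n) <= 1.
Hypothesis m_left : forall j, (j < r)%N -> is_lim_seq (fun n => sample f n (m j n)) (fl j).
Hypothesis m_right : forall j, (j < r)%N -> is_lim_seq (fun n => sample f n (m j n).+1) (fr j).

(* The margin 2 keeps every sample point used on a piece strictly between its knots,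
   whatever the value of f at the jumps. *)
Definition first_index (j n : nat) : nat := if j is k.+1 then (m k n + 2)%N else 0%N.
Definition last_index (j n : nat) : nat := if (j < r)%N then (m j n - 2)%N else (n - 1)%N.

Lemma first_index_lim (j : nat) : (j <= r)%N ->
  is_lim_seq (fun n => INR (first_index j n) / INR n) (knot j).
Proof.
  case: j => [|j] Hj /=.
    by apply: is_lim_seq_ext (is_lim_seq_const 0) => n; rewrite /Rdiv Rmult_0_l.
  by rewrite Hj; apply: (pos_right_lim (c j) (m j)) => n; exact: m_frac.
Qed.

Lemma last_index_lim (j : nat) : (j <= r)%N ->
  is_lim_seq (fun n => INR (last_index j n) / INR n) (knot j.+1).
Proof.
  rewrite /last_index /= => Hj; case: ifP => H.
    by have := c_range j H => ?; apply: (pos_left_lim (c j) (m j)) => [|n]; [lra|exact: m_frac].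
  by apply: (pos_left_lim 1 id) => [|n]; lra.
Qed.

Lemma first_index_piece (j : nat) : (j <= r)%N ->
  eventually (fun n => piece j (INR (first_index j n) / INR n)).
Proof.
  move=> Hj; have Hk := knot_lt j Hj.
  have /is_lim_seq_epsP /(_ (knot j.+1 - knot j) ltac:(lra)) Hlim := first_index_lim j Hj.
  case: j Hj Hk Hlim => [|j] Hj Hk Hlim.
    by apply: filter_imp (eventually_ge 0) => n _; rewrite /Rdiv Rmult_0_l; exact: piece0.
  have Hgt : eventually (fun n => c j < INR (m j n + 2)%N / INR n).
    by apply: (pos_right_gt (c j) (m j)) => // n; exact: m_frac.
  apply: filter_imp (filter_and _ _ Hlim Hgt) => n [h1 h2].
  apply: piece_open => //; move: h1 h2 Hk; rewrite [knot j.+1]/= Hj [first_index _ _]/= => h1 h2 Hk.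
  by split; split_Rabs; lra.
Qed.

Lemma last_index_piece (j : nat) : (j <= r)%N ->
  eventually (fun n => piece j (INR (last_index j n).+1 / INR n)).
Proof.
  move=> Hj; have Hk := knot_lt j Hj; rewrite /last_index.
  case: (boolP (j < r)%N) => Hjr; last first.
    have -> : j = r by lia.
    apply: filter_imp (eventually_ge 1) => n Hn.
    have -> : (n - 1).+1 = n by lia.
    have -> : INR n / INR n = 1 by field; apply: not_0_INR; lia.
    exact: piece1.
  have Hcj := c_range j Hjr.
  have Hlim : is_lim_seq (fun n => INR (m j n - 1)%N / INR n) (c j).
    by apply: (pos_left_lim (c j) (m j)) => [|n]; [lra|exact: m_frac].
  have Hlt : eventually (fun n => INR (m j n - 1)%N / INR n < c j).
    by apply: (pos_left_lt (c j) (m j)) => // [|n]; [lra|exact: m_frac].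
  have Hbig : eventually (fun n => (2 < m j n)%N).
    by apply: (jump_index_large (c j) (m j)) => // [|n]; [lra|exact: m_frac].
  have E : knot j.+1 = c j by rewrite /= Hjr.
  rewrite E in Hk.
  have /is_lim_seq_epsP /(_ (c j - knot j) ltac:(lra)) H := Hlim.
  apply: filter_imp (filter_and _ _ Hbig (filter_and _ _ H Hlt)) => n [h1 [h2 h3]].
  have -> : (m j n - 2).+1 = (m j n - 1)%N by lia.
  by apply: piece_open => //; rewrite E; split_Rabs; lra.
Qed.

Lemma first_last_index (j : nat) : (j <= r)%N ->
  eventually (fun n => (first_index j n <= last_index j n < n)%N).
Proof.
  move=> Hj; have Hk := knot_lt j Hj.
  have Hd : 0 < (knot j.+1 - knot j) / 2 by lra.
  have /is_lim_seq_epsP /(_ _ Hd) H1 := first_index_lim j Hj.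
  have /is_lim_seq_epsP /(_ _ Hd) H2 := last_index_lim j Hj.
  apply: filter_imp (filter_and _ _ (eventually_ge 1) (filter_and _ _ (last_index_piece j Hj)
     (filter_and _ _ H1 H2))) => n [Hn [[[h0 _] _] [h1 h2]]].
  have Hn' : 0 < INR n by apply: lt_0_INR; lia.
  have Hin : 0 < / INR n by apply: Rinv_0_lt_compat.
  have h3 : INR (first_index j n) / INR n < INR (last_index j n) / INR n by split_Rabs; lra.
  have h4 := Rmult_lt_reg_r _ _ _ Hin h3.
  have h5 : INR (last_index j n).+1 <= INR n.
    apply: (Rmult_le_reg_r (/ INR n)) => //; rewrite Rinv_r; last lra.
    exact: (proj2 h0).
  have := INR_lt _ _ h4; have := INR_le _ _ h5; lia.
Qed.

Lemma piece_casorati_lim (j : nat) : (j <= r)%N ->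
  eventually (fun n => 0 < casorati f n (first_index j n)) /\
  is_lim_seq (fun n => casorati f n (last_index j n) / casorati f n (first_index j n)) 1.
Proof.
  move=> Hj; have [C [N H]] := piece_transport j Hj.
  have Hev : eventually (fun n => (N < n)%N /\ (first_index j n <= last_index j n < n)%N /\
      piece j (INR (first_index j n) / INR n) /\ piece j (INR (last_index j n).+1 / INR n)).
    apply: filter_and (eventually_ge N.+1) _; apply: filter_and (first_last_index j Hj) _.
    exact: filter_and (first_index_piece j Hj) (last_index_piece j Hj).
  split; first by apply: filter_imp Hev => n [Hn [h1 [h2 h3]]]; apply: (proj1 (H n _ _ (ltnW Hn) h1 h2 h3)).
  have Hz : is_lim_seq (fun n => exp (C / INR n) - 1) 0.
    apply: (is_lim_seq_val _ (exp (C * 0) - 1)); first by rewrite Rmult_0_r exp_0; ring.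
    apply: is_lim_seq_minus'; last exact: is_lim_seq_const.
    apply: is_lim_seq_exp; apply: is_lim_seq_mult'; first exact: is_lim_seq_const.
    exact: is_lim_seq_inv_INR.
  apply/is_lim_seq_epsP => d Hd.
  have /is_lim_seq_epsP /(_ d Hd) Hz' := Hz.
  apply: filter_imp (filter_and _ _ Hev Hz') => n [[Hn [h1 [h2 h3]]] h4].
  have [W1 W2] := H n _ _ (ltnW Hn) h1 h2 h3.
  set a := casorati f n (first_index j n) in W1 W2 *; set b := casorati f n (last_index j n) in W2 *.
  have -> : b / a - 1 = (b - a) / a by field; lra.
  rewrite /Rdiv Rabs_mult (Rabs_pos_eq (/ a)); last exact/Rlt_le/Rinv_0_lt_compat.
  apply: (Rle_lt_trans _ (exp (C / INR n) - 1)); last by move: h4; clear; split_Rabs; lra.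
  by apply: div_le_of.
Qed.

Definition jump_power (j n : nat) : R := Rpower (gamma (fl j) (fr j)) (INR n * c j - INR (m j n)).

(** The powers of gamma oscillate with n, so the limit exists only after division by their
    product. *)
Lemma casorati_product (j : nat) : (j <= r)%N ->
  is_lim_seq (fun n => casorati f n (last_index j n) / (\prod_(i < j) jump_power i n)%R)
    (/ sqrt (disc (f 0)) * (\prod_(i < j) beta (fl i) (fr i))%R).
Proof.
  have He := proj1 f_lower.
  have Pp k n : 0 < (\prod_(i < k) jump_power i n)%R.
    by apply: (prodR_pos (fun i => jump_power i n)) => i _; exact: exp_pos.
  elim: j => [|j IH] Hj.
    have [Hpos Hlim] := piece_casorati_lim 0 Hj.
    have H0 := proj2 f_lower 0 ltac:(lra).
    have Hsd : 0 < sqrt (disc (f 0)) by apply/sqrt_lt_R0/disc_pos; lra.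
    (* [shoot] starts with 0 and 1 and the phase integral over [0, 0] vanishes: only the amplitude
       at 0 survives, which is where alpha gets its dependence on f(0). *)
    have W0 n : casorati f n 0 = / sqrt (disc (f 0)).
      rewrite /casorati /wkb /phase [shoot _ 1]/= [shoot _ 0]/=.
      rewrite {1 2}/Rdiv !Rmult_0_l RInt_point -exp_logamp ?exp_Ropp; last lra.
      by rewrite /zero /= Rmult_0_r Rplus_0_l; ring.
    rewrite (prodR0 (fun i => beta (fl i) (fr i))).
    apply: (is_lim_seq_val _ (1 * / sqrt (disc (f 0)))); first by rewrite Rmult_comm.
    apply: (is_lim_seq_ext_loc (fun n => casorati f n (last_index 0 n) / casorati f n (first_index 0 n)
        * / sqrt (disc (f 0)))); last by apply: is_lim_seq_mult' => //; exact: is_lim_seq_const.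
    apply: filter_imp Hpos => n _.
    rewrite (prodR0 (fun i => jump_power i n)) [first_index 0 n]/= W0.
    by field; lra.
  have Hcj := c_range j Hj.
  have [Hpos Hlim] := piece_casorati_lim j.+1 Hj.
  have [Hpos0 Hlim0] := piece_casorati_lim j (ltnW Hj).
  have HJ : is_lim_seq (fun n => casorati f n (first_index j.+1 n) /
      (casorati f n (last_index j n) * jump_power j n)) (beta (fl j) (fr j)).
    rewrite /last_index Hj; apply: (jump_casorati f e) => //.
    - exact: loglam_f_integrable.
    - lra.
    - exact: f_left.
    - exact: f_right.
    - exact: fl_lower.
    - exact: fr_lower.
    - by move=> n; exact: m_frac.
    - exact: m_left.
    - exact: m_right.
    - lra.
  have Hnz : eventually (fun n => casorati f n (last_index j n) <> 0).
    apply: filter_imp (is_lim_seq_neq0 _ _ Hlim0 R1_neq_R0) => n Hn Z.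
    by apply: Hn; rewrite Z /Rdiv Rmult_0_l.
  (* Three factors telescope: the Casoratian up to the jump, its change across the jump (limit
     beta), and its change along the next piece (limit 1). *)
  have Hprod := is_lim_seq_mult' _ _ _ _ (is_lim_seq_mult' _ _ _ _ (IH (ltnW Hj)) HJ) Hlim.
  rewrite (prodR_recr (fun i => beta (fl i) (fr i))).
  apply: (is_lim_seq_val _ _ _ _ (is_lim_seq_ext_loc _ _ _ _ Hprod)); first by ring.
  apply: filter_imp (filter_and _ _ Hpos Hnz) => n [h1 h2].
  rewrite (prodR_recr (fun i => jump_power i n)).
  have := Pp j n; have h3 : 0 < jump_power j n by exact: exp_pos.
  move: (\prod_(i < j) jump_power i n)%R (jump_power j n) h3 => p q h3 h4.
  by field; repeat split; lra.
Qed.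

Lemma alpha_lam : alpha f = lam (f 1) / sqrt (disc (f 1)) * / sqrt (disc (f 0)).
Proof.
  have He := proj1 f_lower.
  have H0 := proj2 f_lower 0 ltac:(lra); have H1 := proj2 f_lower 1 ltac:(lra).
  have d0 := disc_pos (f 0) ltac:(lra); have d1 := disc_pos (f 1) ltac:(lra).
  have s0 := sqrt_lt_R0 _ d0; have s1 := sqrt_lt_R0 _ d1.
  rewrite /alpha sqrt_mult; [|nra|nra].
  rewrite -/(disc (f 0)) -/(disc (f 1)) sqrt_mult; [|lra|lra].
  by rewrite /lam; field; lra.
Qed.

(** A bound independent of n, available because the exponent stays in [0, 1]. It is what allows
    passing from a quotient with limit to a difference tending to 0. *)
Lemma jump_power_bound (j n : nat) : (j < r)%N ->
  0 < jump_power j n <= exp (Rabs (loglam (fr j) - loglam (fl j))).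
Proof.
  move=> Hj; split; first exact: exp_pos.
  have He := proj1 f_lower; have := fl_lower j Hj; have := fr_lower j Hj => h1 h2.
  rewrite /jump_power Rpower_gamma; [|lra|lra].
  apply: exp_le_mono; apply: Rle_trans (Rle_abs _) _.
  have [t0 t1] := m_frac j n Hj.
  rewrite Rabs_mult (Rabs_pos_eq (_ - INR _)) // -[X in _ <= X]Rmult_1_l.
  by apply: Rmult_le_compat_r; first exact: Rabs_pos.
Qed.

Lemma Dn_asymptotics :
  is_lim_seq (fun n => Dn f n / Gf f ^ n -
    alpha f * (\prod_(j < r) (beta (fl j) (fr j) * jump_power j n))%R) 0.
Proof.
  have H1 := f_at_left_knot r (leqnn r).
  rewrite /= !ltnn in H1.
  have Hend := end_casorati f e f_lower loglam_f_integrable H1.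
  have Hprod := casorati_product r (leqnn r).
  have [Hpos Hlim] := piece_casorati_lim r (leqnn r).
  rewrite /last_index ltnn in Hprod Hlim.
  have Hnz : eventually (fun n => casorati f n (n - 1) <> 0).
    apply: filter_imp (is_lim_seq_neq0 _ _ Hlim R1_neq_R0) => n Hn Z.
    by apply: Hn; rewrite Z /Rdiv Rmult_0_l.
  set P := fun n => (\prod_(i < r) jump_power i n)%R in Hprod *.
  set b := (\prod_(i < r) beta (fl i) (fr i))%R in Hprod *.
  have Hmul := is_lim_seq_mult' _ _ _ _ Hend Hprod.
  have HP n : 0 < P n by apply: (prodR_pos (fun i => jump_power i n)) => i _; exact: exp_pos.
  set K := (\prod_(i < r) exp (Rabs (loglam (fr i) - loglam (fl i))))%R.
  have HK n : P n <= K.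
    apply: (prodR_le (fun i => jump_power i n) (fun i => exp (Rabs (loglam (fr i) - loglam (fl i))))).
    by move=> i Hi; exact: jump_power_bound.
  have HK0 : 0 < K by have := HP 0%N; have := HK 0%N; lra.
  rewrite -Rmult_assoc -alpha_lam in Hmul.
  apply/is_lim_seq_epsP => d Hd.
  (* The difference to be estimated is [P n] times the error of the convergent quotient, and
     [P n <= K]. *)
  have /is_lim_seq_epsP /(_ (d / K) ltac:(exact: Rdiv_lt_0_compat)) H := Hmul.
  apply: filter_imp (filter_and _ _ Hnz H) => n [h1 h2].
  rewrite (prodR_mul (fun j => beta (fl j) (fr j)) (fun j => jump_power j n)) -/b -/(P n) Rminus_0_r.
  have hP := HP n; have hK := HK n.
  have -> : Dn f n / Gf f ^ n - alpha f * (b * P n) =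
    P n * (Dn f n / Gf f ^ n / casorati f n (n - 1) * (casorati f n (n - 1) / P n) - alpha f * b).
    by field; repeat split; try lra; apply/Rgt_not_eq/pow_lt/exp_pos.
  rewrite Rabs_mult Rabs_pos_eq; last lra.
  apply: (Rle_lt_trans _ (K * Rabs (Dn f n / Gf f ^ n / casorati f n (n - 1) *
            (casorati f n (n - 1) / P n) - alpha f * b))).
    by apply: Rmult_le_compat_r; first exact: Rabs_pos.
  have -> : d = K * (d / K) by field; lra.
  exact: Rmult_lt_compat_l.
Qed.

End PiecewiseSmooth.

(** * One-sided continuity at the jumps and the choice of sample indices *)

Lemma lim_at_left_closed (f : R -> R) (c l : R) (u : nat -> R) :
  filterlim f (at_left c) (locally l) -> f c = l ->
  eventually (fun n => u n <= c) -> is_lim_seq u c -> is_lim_seq (fun n => f (u n)) l.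
Proof.
  move=> /filterlim_locally Hf Hc Hu /is_lim_seq_epsP Hl; apply/is_lim_seq_epsP => d Hd.
  have [eta Heta] := Hf (mkposreal d Hd).
  apply: filter_imp (filter_and _ _ Hu (Hl eta (cond_pos eta))) => n [h1 h2].
  case: (Req_dec (u n) c) => [->|Hne]; first by rewrite Hc Rminus_diag_eq // Rabs_R0.
  by apply: (Heta (u n) h2); lra.
Qed.

Lemma lim_at_right_closed (f : R -> R) (c l : R) (u : nat -> R) :
  filterlim f (at_right c) (locally l) -> f c = l ->
  eventually (fun n => c <= u n) -> is_lim_seq u c -> is_lim_seq (fun n => f (u n)) l.
Proof.
  move=> /filterlim_locally Hf Hc Hu /is_lim_seq_epsP Hl; apply/is_lim_seq_epsP => d Hd.
  have [eta Heta] := Hf (mkposreal d Hd).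
  apply: filter_imp (filter_and _ _ Hu (Hl eta (cond_pos eta))) => n [h1 h2].
  case: (Req_dec (u n) c) => [->|Hne]; first by rewrite Hc Rminus_diag_eq // Rabs_R0.
  by apply: (Heta (u n) h2); lra.
Qed.

Lemma INR_to_nat (z : Z) : (-1 < IZR z) -> INR (Z.to_nat z) = IZR z.
Proof.
  move=> /lt_IZR Hz; rewrite INR_IZR_INZ Z2Nat.id //; lia.
Qed.

Lemma INR_to_nat_floor (x : R) : 0 <= x -> INR (Z.to_nat (Int_part x)) = floorR x.
Proof. by move=> Hx; have [h1 h2] := base_Int_part x; apply: INR_to_nat; lra. Qed.

Lemma INR_to_nat_ceil (x : R) : 0 < x ->
  INR (Z.to_nat (- Int_part (- x) - 1)) = ceilR x - 1.
Proof.
  move=> Hx; have [h1 h2] := base_Int_part (- x).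
  by rewrite INR_to_nat minus_IZR opp_IZR /ceilR /floorR; lra.
Qed.

Theorem theorem1p3 (f : R -> R) (r : nat) (c fl fr : nat -> R) (eps : R)
  (Hc_range : forall j : nat, (j < r)%N -> 0 < c j < 1)
  (Hc_incr : forall j : nat, (j.+1 < r)%N -> c j < c j.+1)
  (Hsmooth : twice_diff_bdd (punctured r c) f)
  (Hleft : forall j : nat, (j < r)%N -> filterlim f (at_left (c j)) (locally (fl j)))
  (Hright : forall j : nat, (j < r)%N -> filterlim f (at_right (c j)) (locally (fr j)))
  (Hjump : forall j : nat, (j < r)%N -> fl j <> fr j)
  (Heps : 0 < eps)
  (Hbound : forall x : R, 0 <= x <= 1 -> 2 + eps < f x) :
  ((forall j : nat, (j < r)%N -> f (c j) = fl j) ->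
     is_lim_seq (fun n : nat => Dn f n / Gf f ^ n - main_term f r c fl fr fracR n) 0)
  /\
  ((forall j : nat, (j < r)%N -> f (c j) = fr j) ->
     is_lim_seq (fun n : nat => Dn f n / Gf f ^ n - main_term f r c fl fr fracR' n) 0).
Proof.
  have Hlow : unif_lower f eps by [].
  have Hnc n j : (j < r)%N -> 0 <= INR n * c j.
    by move=> /Hc_range ?; apply: Rmult_le_pos; [exact: pos_INR|lra].
  have Hnc1 n j : (0 < n)%N -> (j < r)%N -> 0 < INR n * c j.
    by move=> Hn /Hc_range ?; apply: Rmult_lt_0_compat; [apply: lt_0_INR; lia|lra].
  have Hdiv n a : (0 < n)%N -> a / INR n * INR n = a.
    by move=> Hn; field; apply: not_0_INR; lia.
  have Hpos n : (0 < n)%N -> 0 < INR n by move=> Hn; apply: lt_0_INR; lia.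
  split=> Hcont.
  (* Under left continuity a sample point equal to c_j counts as lying on the left, so m is the
     floor and n c_j - m = {n c_j}. *)
  - set m := fun j n => Z.to_nat (Int_part (INR n * c j)).
    have Hm j n : (j < r)%N -> INR (m j n) = floorR (INR n * c j).
      by move=> Hj; apply: INR_to_nat_floor; exact: Hnc.
    have Hfrac j n : (j < r)%N -> 0 <= INR n * c j - INR (m j n) < 1.
      by move=> Hj; rewrite Hm // /floorR; have := base_Int_part (INR n * c j); lra.
    have Hfrac' j n (Hj : (j < r)%N) : 0 <= INR n * c j - INR (m j n) <= 1.
      by have := Hfrac j n Hj; lra.
    have Hml j (Hj : (j < r)%N) : is_lim_seq (fun n => sample f n (m j n)) (fl j).
      (* Here m / n may equal c_j, so the limit from the left is completed by the value of f at c_j;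
         the next sample point lies strictly to the right. *)
      apply: lim_at_left_closed (Hleft j Hj) (Hcont j Hj) _ _.
        apply: filter_imp (eventually_ge 1) => n Hn.
        apply: (Rmult_le_reg_r (INR n)); first exact: Hpos.
        by rewrite Hdiv //; have := Hfrac j n Hj; lra.
      by apply: (jump_pos_lim (c j) (m j)) => n; exact: Hfrac'.
    have Hmr j (Hj : (j < r)%N) : is_lim_seq (fun n => sample f n (m j n).+1) (fr j).
      apply: (filterlim_comp _ _ _ (fun n => INR (m j n).+1 / INR n) f _ _ _ _ (Hright j Hj)).
      apply: filterlim_at_right_seq.
        apply: filter_imp (eventually_ge 1) => n Hn.
        apply: (Rmult_lt_reg_r (INR n)); first exact: Hpos.
        by rewrite Hdiv // S_INR; have := Hfrac j n Hj; lra.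
      apply: is_lim_seq_ext (pos_right_lim (c j) (m j) _ 1) => n; first by rewrite addn1.
      exact: Hfrac'.
    apply: is_lim_seq_ext (Dn_asymptotics f r c fl fr eps Hc_range Hc_incr Hsmooth Hleft Hright
       Hlow m Hfrac' Hml Hmr) => n.
    rewrite /main_term; congr (_ - _ * _); apply: eq_bigr => j _.
    by rewrite /jump_power /fracR Hm.
  (* Under right continuity a sample point equal to c_j counts as lying on the right: m is the
     ceiling minus one, and n c_j - m = {n c_j}' lies in (0, 1]. *)
  - set m := fun j n => Z.to_nat (- Int_part (- (INR n * c j)) - 1).
    have Hm j n : (0 < n)%N -> (j < r)%N -> INR (m j n) = ceilR (INR n * c j) - 1.
      by move=> Hn Hj; apply: INR_to_nat_ceil; exact: Hnc1.
    have Hfrac j n : (0 < n)%N -> (j < r)%N -> 0 < INR n * c j - INR (m j n) <= 1.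
      move=> Hn Hj; rewrite Hm // /ceilR /floorR.
      by have := base_Int_part (- (INR n * c j)); lra.
    have Hfrac' j n (Hj : (j < r)%N) : 0 <= INR n * c j - INR (m j n) <= 1.
      case: n => [|n]; last by have := Hfrac j n.+1 (ltn0Sn n) Hj; lra.
      (* At n = 0 the ceiling minus one is -1, which [Z.to_nat] truncates to 0; hence [Hm] requires
         n > 0. *)
      have -> : m j 0%N = 0%N.
        rewrite /m /= Rmult_0_l Ropp_0.
        by rewrite -(Int_part_spec 0 0) //=; lra.
      by rewrite /= Rmult_0_l; lra.
    have Hml j (Hj : (j < r)%N) : is_lim_seq (fun n => sample f n (m j n)) (fl j).
      apply: (filterlim_comp _ _ _ (fun n => INR (m j n) / INR n) f _ _ _ _ (Hleft j Hj)).
      apply: filterlim_at_left_seq.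
        apply: filter_imp (eventually_ge 1) => n Hn.
        apply: (Rmult_lt_reg_r (INR n)); first exact: Hpos.
        by rewrite Hdiv //; have := Hfrac j n Hn Hj; lra.
      by apply: (jump_pos_lim (c j) (m j)) => n; exact: Hfrac'.
    have Hmr j (Hj : (j < r)%N) : is_lim_seq (fun n => sample f n (m j n).+1) (fr j).
      apply: lim_at_right_closed (Hright j Hj) (Hcont j Hj) _ _.
        apply: filter_imp (eventually_ge 1) => n Hn.
        apply: (Rmult_le_reg_r (INR n)); first exact: Hpos.
        by rewrite Hdiv // S_INR; have := Hfrac j n Hn Hj; lra.
      apply: is_lim_seq_ext (pos_right_lim (c j) (m j) _ 1) => n; first by rewrite addn1.
      exact: Hfrac'.
    apply: is_lim_seq_ext_loc (Dn_asymptotics f r c fl fr eps Hc_range Hc_incr Hsmooth Hleft Hright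
       Hlow m Hfrac' Hml Hmr).
    apply: filter_imp (eventually_ge 1) => n Hn.
    rewrite /main_term; congr (_ - _ * _); apply: eq_bigr => j _.
    rewrite /jump_power /fracR' Hm //.
    by replace (INR n * c j - (ceilR (INR n * c j) - 1)) with (1 + INR n * c j - ceilR (INR n * c j)) by ring.
Qed.
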